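(* Let $k \geq 2$ be an integer. Let $q$ be a prime power such that $q \equiv 1 \pmod{k}$ if $q$ is even, or $q \equiv 1 \pmod{2k}$ if $q$ is odd. Let $\chi_k$ be a multiplicative character of $\mathbb{F}_q^*$ of order $k$. Then \begin{multline*} \mathcal{K}_4(G_k(q)) = \frac{q(q-1)}{24 \cdot k^6}\Biggl[10\,\mathbb{R}_k(q)^2 + 5(q-2k^2+1)\mathbb{R}_k(q) - 15\,\mathbb{S}_k(q) + q^2 - 5(2k^2-3k+2)q \\ + 15k^3 - 10k^2 + 1 + q^2\sum_{\vec t\in X_k}{}_3F_2(\vec t\mid 1)_{q,k}\Biggr], \end{multline*} where $X_k := \{(t_1,\dots,t_5)\in(\mathbb{Z}_k)^5 : \text{each of } t_1,t_2,t_3 \text{ is different from each of } 0,t_4,t_5, \text{ and } t_1+t_2+t_3\neq t_4+t_5\}$, \[ \mathbb{R}_k(q) := \sum_{\substack{s,t=1\\ s+t\not\equiv 0\ (k)}}^{k-1} J(\chi_k^s,\chi_k^t), \qquad \mathbb{S}_k(q) := \sum_{\substack{s,t,v=1\\ s+t,\ v+t,\ v-s\not\equiv 0\ (k)}}^{k-1} J(\chi_k^s,\chi_k^t)\,J(\bar{\chi_k}^s,\chi_k^v). \]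
   Context: For a graph $G$, $\mathcal{K}_m(G)$ denotes the number of complete subgraphs of order $m$ in $G$. For $k,q$ as in the claim, $S_k$ is the subgroup of $\mathbb{F}_q^*$ of order $\frac{q-1}{k}$ of $k$-th power residues, and the generalized Paley graph $G_k(q)$ has vertex set $\mathbb{F}_q$ with $ab$ an edge iff $a-b\in S_k$. Every multiplicative character $\chi$ of $\mathbb{F}_q^*$ (including the trivial character $\varepsilon$) is extended by $\chi(0)=0$; $\bar\chi$ is the inverse of $\chi$. $J(A,B)=\sum_{a\in\mathbb{F}_q}A(a)B(1-a)$ and $\binom{A}{B}:=\frac{B(-1)}{q}J(A,\bar B)$. Greene's hypergeometric function is ${}_{3}F_2\left(\begin{matrix}A_0,&A_1,&A_2\\ &B_1,&B_2\end{matrix}\Big|\,\lambda\right)_q := \frac{q}{q-1}\sum_{\chi}\binom{A_0\chi}{\chi}\binom{A_1\chi}{B_1\chi}\binom{A_2\chi}{B_2\chi}\chi(\lambda)$, summed over all multiplicative characters $\chi$. For $\vec t\in(\mathbb{Z}_k)^5$, ${}_3F_2(\vec t\mid\lambda)_{q,k}:={}_3F_2\left(\begin{matrix}\chi_k^{t_1},&\chi_k^{t_2},&\chi_k^{t_3}\\ &\chi_k^{t_4},&\chi_k^{t_5}\end{matrix}\Big|\,\lambda\right)_q$. *)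

(* Defs.v *)
From HB Require Import structures.
From mathcomp Require Import all_boot all_order all_algebra.
From mathcomp Require Import all_fingroup all_solvable all_field all_character.

Set Implicit Arguments.
Unset Strict Implicit.
Unset Printing Implicit Defensive.

Import Order.TTheory GRing.Theory Num.Theory.
Local Open Scope ring_scope.

Definition complete_subgraphs (V : finType) (e : rel V) (m : nat) :
    {set {set V}} :=
  [set C : {set V} |
    (#|C| == m) && [forall x in C, forall y in C, (x != y) ==> e x y]].

Definition num_complete (V : finType) (e : rel V) (m : nat) : nat :=
  #|complete_subgraphs e m|.

Definition power_residues (F : finFieldType) (k : nat) : {set F} :=
  [set x ^+ k | x in [set~ (0 : F)]].

Definition gen_paley (F : finFieldType) (k : nat) : rel F :=
  fun a b => a - b \in power_residues F k.

(* Functions on F^*, all of them class functions since F^* is abelian; the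
   multiplicative characters of F are those satisfying [is a linear_char].
   On these, the ring operations of 'CF are the operations of the character
   group: 1 is the trivial character and psi^-1 the inverse character. *)
Notation mulfun F := 'CF([set: {unit F}]).

(* Extension to F by zero, also for the trivial character. *)
Definition ext0 (F : finFieldType) (psi : mulfun F) (a : F) : algC :=
  if insub a is Some u then psi u else 0.

Definition jacobi_sum (F : finFieldType) (A B : mulfun F) : algC :=
  \sum_(a : F) ext0 A a * ext0 B (1 - a).

Definition greene_binom (F : finFieldType) (A B : mulfun F) : algC :=
  ext0 B (- 1) / #|F|%:R * jacobi_sum A B^-1.

Definition greene_3F2 (F : finFieldType) (A0 A1 A2 B1 B2 : mulfun F)
    (lambda : F) : algC :=
  #|F|%:R / (#|F|%:R - 1) *
  \sum_(psi <- irr [set: {unit F}] | psi \is a linear_char)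
    greene_binom (A0 * psi) psi * greene_binom (A1 * psi) (B1 * psi) *
    greene_binom (A2 * psi) (B2 * psi) * ext0 psi lambda.

Definition Z5 (k : nat) : finType := ('Z_k * 'Z_k * 'Z_k * 'Z_k * 'Z_k)%type.

(* Exponents in 'Z_k are read through their representatives in {0, ..., k-1};
   this is independent of the choice of representative when chi ^+ k = 1. *)
Definition greene_3F2_exp (F : finFieldType) (k : nat) (chi : mulfun F)
    (t : Z5 k) (lambda : F) : algC :=
  let: (t1, t2, t3, t4, t5) := t in
  greene_3F2 (chi ^+ t1) (chi ^+ t2) (chi ^+ t3) (chi ^+ t4) (chi ^+ t5)
    lambda.

Definition X_set (k : nat) : {set Z5 k} :=
  [set t : Z5 k | let: (t1, t2, t3, t4, t5) := t in
    all (fun x => x \notin [:: 0; t4; t5]) [:: t1; t2; t3]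
    && (t1 + t2 + t3 != t4 + t5)].

Definition R_sum (F : finFieldType) (k : nat) (chi : mulfun F) : algC :=
  \sum_(1 <= s < k) \sum_(1 <= t < k | s + t != 0 %[mod k])
    jacobi_sum (chi ^+ s) (chi ^+ t).

Definition S_sum (F : finFieldType) (k : nat) (chi : mulfun F) : algC :=
  \sum_(1 <= s < k) \sum_(1 <= t < k)
    \sum_(1 <= v < k | [&& s + t != 0 %[mod k], v + t != 0 %[mod k]
                         & v != s %[mod k]])
      jacobi_sum (chi ^+ s) (chi ^+ t) * jacobi_sum (chi^-1 ^+ s) (chi ^+ v).

(* Main.v *)
Require Import Defs.
From mathcomp Require Import all_boot all_order all_algebra.
From mathcomp Require Import all_fingroup all_solvable all_field all_character.
From mathcomp Require Import ring.

Import Order.TTheory GRing.Theory Num.Theory.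
Local Open Scope ring_scope.

(* By translation and scaling, 24 K_4 = q (q-1)/k times the number of (x, y)
   such that x, y, 1-x, 1-y, x-y are all k-th power residues.  Expanding each
   residue indicator in powers of chi gives k^-5 times the sum over (Z_k)^5 of
     T(a,b,c,d,e) = sum_{x,y} chi^a(x) chi^b(y) chi^c(1-x) chi^d(1-y) chi^e(x-y),
   and each T is q^2 times a 3F2 at 1.  The five points 0, 1, oo, x, y of the
   projective line give an S_5-symmetry of T permuting ten linear forms in the
   exponents, one for each pair of points; X_k is the set where none of them
   vanishes.  When some of them vanish, weighting T by 1/(number of vanishing
   forms) and using the symmetry reduces the sum to ten times the one over
   e = 0, where T(a,b,c,d,0) = J(a,c) J(b,d) - J(a+b,c+d). *)

(** * Zero patterns of the ten boundary exponents *)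

(** The obstacle is the overlap of the ten conditions: the ten hyperplanes in (Z_k)^5 meet in many
    strata, and inclusion-exclusion over all of them would be long. The weight replaces it by the
    single stratum e = 0, at the price of sums of reciprocals that are counts of points on a few
    lines. The trivial character is 0 at 0, so on this stratum it removes the diagonal x = y; hence
    the term J(a+b,c+d). Each Jacobi sum is then split into a generic part and an explicit
    degenerate one. Generic times generic gives 10 R^2 - 15 S, where 15 = 10 * 3/2 reflects three
    possible coincidences, each lowering the weight from 1 to 1/2. The products J(a,c) J(-a,-c) = q
    and the degenerate parts give the remaining polynomial terms. The congruence on q makes -1 a
    k-th power: the graph is undirected, and chi^t(-1) = 1 lets the S_5-symmetry hold without
    signs. *)

Section ZeroPatterns.
Variable Z : finComNzRingType.
Implicit Types a b c d e x y p A C : Z.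

Definition isz (x : Z) : nat := (x == 0)%R.
Arguments isz x%_ring_scope.

(* The ten arguments are, up to sign, the exponents attached to the pairs
   0x, 0y, 1x, 1y, xy, oox, ooy, oo1, oo0, 01: the four exponents attached to
   each of the five points sum to 0. *)
Definition zero_count a b c d e : nat :=
  (isz a + isz b + isz c + isz d + isz e + isz (a + c + e) + isz (b + d + e)
   + isz (a + b + e) + isz (c + d + e) + isz (a + b + c + d + e))%N.

(** A tuple lying on n > 0 of the ten hyperplanes receives 1/n from each of them, hence 1 in total.
    For n = 0 the value is 0^-1 = 0. *)
Definition wt a b c d e : algC := (zero_count a b c d e)%:R^-1.

Local Notation k := (#|Z|%:R : algC).
Definition ind0 (x : Z) : algC := (isz x)%:R.

Lemma sum_const_card (u : algC) : \sum_(x : Z) u = k * u.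
Proof. by rewrite sumr_const mulr_natl. Qed.

Lemma sum_delta (f : Z -> algC) (g : Z -> Z) p :
  (forall x, (g x == 0) = (x == p)) -> \sum_x ind0 (g x) * f x = f p.
Proof.
move=> gP; rewrite (bigD1 p) //= /ind0/isz gP eqxx mul1r big1 ?addr0 // => x xp.
by rewrite gP (negbTE xp) mul0r.
Qed.

Lemma sum_ind0 (f : Z -> algC) : \sum_x ind0 x * f x = f 0.
Proof. exact: sum_delta. Qed.

Lemma sum_ind0D p (f : Z -> algC) : \sum_x ind0 (p + x) * f x = f (- p).
Proof. by apply: sum_delta => x; rewrite addrC addr_eq0. Qed.

Lemma sum_ind0B p (f : Z -> algC) : \sum_x ind0 (p - x) * f x = f p.
Proof. by apply: sum_delta => x; rewrite subr_eq0 eq_sym. Qed.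

Lemma iszN x : isz (- x) = isz x. Proof. by rewrite /isz oppr_eq0. Qed.
Lemma isz0 : isz 0 = 1%N. Proof. by rewrite /isz eqxx. Qed.

(** The denominators count the vanishing forms of, for instance, (0,0,c,d,0): ten at the origin, six
    at the 3(k-1) other points of the lines c = 0, d = 0, c+d = 0, four elsewhere. *)
Lemma sum_inv4 : \sum_c \sum_d (4 + 2 * isz c + 2 * isz d + 2 * isz (c + d))%:R^-1
  = 1/10 + (k - 1) / 2 + (k-1)*(k-2)/4 :> algC.
Proof.
(* The reciprocal is interpolated by a polynomial in the indicators, which delta sums evaluate. The
   drop on each line is 1/6 - 1/4 = -1/12; at the common point the three drops cancel 1/4, so 1/10
   is added there. *)
have E c d : (4 + 2 * isz c + 2 * isz d + 2 * isz (c + d))%:R^-1 =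
   ind0 d * (- 12^-1 + 10^-1 * ind0 c) + ind0 (c + d) * (- 12^-1)
   + (4^-1 - 12^-1 * ind0 c) :> algC.
  rewrite /ind0 /isz; case: (c =P 0) => [->|/eqP/negbTE hc];
  case: (d =P 0) => [->|/eqP/negbTE hd]; rewrite ?add0r ?addr0 ?eqxx ?hc ?hd /=; try by field.
  by case: (_ == _) => /=; field.
have F c : \sum_d (4 + 2 * isz c + 2 * isz d + 2 * isz (c + d))%:R^-1
    = ind0 c * (10^-1 - k / 12) + (k/4 - 6^-1) :> algC.
  under eq_bigr do rewrite E.
  by rewrite !big_split /= sum_ind0 sum_ind0D !sum_const_card; field.
by under eq_bigr do rewrite F; rewrite big_split /= sum_ind0 ?sum_const_card; field.
Qed.

(** The pattern of tuples such as (b,0,0,c,0): ten forms vanish at the origin, six on the rest of b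
    = 0 or c = 0, four on the rest of b+c = 0, three elsewhere. *)
Lemma sum_inv3 : \sum_b \sum_c (3 + 3 * isz b + 3 * isz c + isz (b + c))%:R^-1
  = 1/10 + 2 * (k - 1) / 6 + (k-1)/4 + (k-1)*(k-2)/3 :> algC.
Proof.
have E c d : (3 + 3 * isz c + 3 * isz d + isz (c + d))%:R^-1 =
   ind0 d * (- 6^-1 + 11/60 * ind0 c) + ind0 (c + d) * (- 12^-1) + (3^-1 - 6^-1 * ind0 c)  :> algC.
  rewrite /ind0 /isz; case: (c =P 0) => [->|/eqP/negbTE hc];
  case: (d =P 0) => [->|/eqP/negbTE hd]; rewrite ?add0r ?addr0 ?eqxx ?hc ?hd /=; try by field.
  by case: (_ == _) => /=; field.
have F c : \sum_d (3 + 3 * isz c + 3 * isz d + isz (c + d))%:R^-1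
    = ind0 c * (11/60 - k / 6) + (k/3 - 1/4) :> algC.
  under eq_bigr do rewrite E.
  by rewrite !big_split /= sum_ind0 sum_ind0D !sum_const_card; field.
by under eq_bigr do rewrite F; rewrite big_split /= sum_ind0 ?sum_const_card; field.
Qed.

Lemma sum_inv6 : \sum_d (6 + 4 * isz d)%:R^-1 = 1/10 + (k - 1) / 6 :> algC.
Proof.
have E d : (6 + 4 * isz d)%:R^-1 = ind0 d * (10^-1 - 6^-1) + 6^-1 :> algC.
  by rewrite /ind0 /isz; case: (_ == _) => /=; field.
by under eq_bigr do rewrite E; rewrite big_split /= sum_ind0 ?sum_const_card; field.
Qed.

Lemma sum_ind0DB p r (f : Z -> algC) : \sum_x ind0 (p + (r - x)) * f x = f (p + r).
Proof. by apply: sum_delta => x; rewrite addrA subr_eq0 eq_sym. Qed.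

(** This lemma and the next three are the transpositions of x and y, 0 and 1, 0 and oo, 1 and x.
    They form a path through the five points, hence generate S_5; each permutes the ten forms up to
    sign. *)
Lemma wt_xy a b c d e : wt a b c d e = wt b a d c e.
Proof.
by congr (_%:R^-1); rewrite /zero_count (addrC b a) (addrC d c) -!addrA (addrCA d c) !addrA; ring.
Qed.

Lemma wt_01 a b c d e : wt a b c d e = wt c d a b e.
Proof.
congr (_%:R^-1); rewrite /zero_count (addrC c a) (addrC d b).
have -> : c + d + a + b + e = a + b + c + d + e by ring.
ring.
Qed.

Lemma wt_0oo a b c d e : wt a b c d e = wt (- (a + c + e)) (- (b + d + e)) c d e.
Proof.
congr (_%:R^-1); rewrite /zero_count.
have -> : - (a + c + e) + c + e = - a by ring.
have -> : - (b + d + e) + d + e = - b by ring.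
have -> : - (a + c + e) - (b + d + e) + e = - (a + b + c + d + e) by ring.
have -> : - (a + c + e) - (b + d + e) + c + d + e = - (a + b + e) by ring.
by rewrite !iszN; ring.
Qed.

Lemma wt_1x a b c d e : wt a b c d e = wt (- (a + b + c + d + e)) b c e d.
Proof.
congr (_%:R^-1); rewrite /zero_count.
have -> : - (a + b + c + d + e) + c + d = - (a + b + e) by ring.
have -> : - (a + b + c + d + e) + b + d = - (a + c + e) by ring.
have -> : - (a + b + c + d + e) + b + c + e + d = - a by ring.
rewrite !iszN -!addrA (addrC e d); ring.
Qed.

(** Four forms vanish at d = 0, three at d = -c and at d = -(a+c), two elsewhere; the hypotheses
    make these three values of d distinct. *)
Lemma line_generic a c : a != 0 -> c != 0 -> a + c != 0 ->
  \sum_d wt a 0 c d 0 = k / 2 - 7/12.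
Proof.
move=> /negbTE a0 /negbTE c0 /negbTE ac0.
have E d : wt a 0 c d 0 =
    ind0 d * (- 4^-1) + ind0 (c + d) * (- 6^-1) + ind0 ((a + c) + d) * (- 6^-1) + 2^-1.
  rewrite /wt /zero_count /ind0 /isz !addr0 !add0r eqxx a0 c0 ac0.
  case: (d =P 0) => [->|/eqP/negbTE d0]; first by rewrite !addr0 c0 ac0 /=; field.
  case: (c + d =P 0) => [cd|/eqP/negbTE cd].
    by rewrite -addrA cd addr0 a0 /=; field.
  by case: (_ == _) => /=; field.
by under eq_bigr do rewrite E; rewrite !big_split /= sum_ind0 !sum_ind0D !sum_const_card; field.
Qed.

Definition fibre A C : algC := \sum_a \sum_c wt a (A - a) c (C - c) 0.

(** The number of vanishing forms is one plus the number of lines a = 0, a = A, c = 0, c = C, a+c =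
    0, a+c = A+C through (a,c). There are two triple points, six double points and 6k-18 simple
    points, of weights 1/4, 1/3, 1/2; all others have weight 1. *)
Lemma fibre_generic A C : A != 0 -> C != 0 -> A + C != 0 ->
  fibre A C = k ^+ 2 - 3 * k + 7/2.
Proof.
move=> /negbTE A0 /negbTE C0 /negbTE AC0.
have E a c : wt a (A - a) c (C - c) 0 =
    ind0 c * (- 2^-1 + 3/4 * ind0 a + 3^-1 * ind0 (A - a) + 3^-1 * ind0 (A - a + (C - c)))
    + ind0 (C - c) * (- 2^-1 + 3/4 * ind0 (A - a) + 3^-1 * ind0 a + 3^-1 * ind0 (a + c))
    + ind0 (a + c) * (- 2^-1 + 3^-1 * ind0 (A - a))
    + ind0 (A - a + (C - c)) * (- 2^-1 + 3^-1 * ind0 a)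
    + (1 - 2^-1 * ind0 a - 2^-1 * ind0 (A - a)).
  rewrite /wt /zero_count.
  have -> : a + (A - a) + 0 = A by ring.
  have -> : c + (C - c) + 0 = C by ring.
  have -> : a + (A - a) + c + (C - c) + 0 = A + C by ring.
  rewrite !addr0 isz0 /ind0 /isz A0 C0 AC0.
  case: (a =P 0) => [->|/eqP/negbTE a0]; last case: (a =P A) => [->|/eqP a1];
  (case: (c =P 0) => [->|/eqP/negbTE c0]; last case: (c =P C) => [->|/eqP c1]);
  rewrite ?subrr ?subr0 ?add0r ?addr0 ?eqxx ?A0 ?C0 ?AC0 ?a0 ?c0
    ?(subr_eq0 A) ?(subr_eq0 C) ?(eq_sym A) ?(eq_sym C) ?(negbTE a1) ?(negbTE c1) /=;
    try by field.
  - by case: (_ == _) => /=; field.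
  - by case: (_ == _) => /=; field.
  - by case: (_ == _) => /=; field.
  - by case: (_ == _) => /=; field.
  case: (a + c =P 0) => [ac|/eqP/negbTE ac0].
    have -> : A - a + (C - c) = A + C - (a + c) by ring.
    by rewrite ac subr0 AC0 /=; field.
  by case: (_ == _) => /=; field.
have F a : \sum_c wt a (A - a) c (C - c) 0 =
    ind0 a * (17/12 - k / 2) + ind0 (A - a) * (17/12 - k / 2)
    + ind0 (A + C - a) * 3^-1 + ind0 (C + a) * 3^-1 + (k - 2).
  under eq_bigr do rewrite E.
  rewrite !big_split /= sum_ind0 sum_ind0B sum_ind0D sum_ind0DB !sum_const_card subr0.
  have -> : A - a + C = A + C - a by ring.
  by rewrite (addrC C a); field.
rewrite /fibre; under eq_bigr do rewrite F.
by rewrite !big_split /= sum_ind0 !sum_ind0B sum_ind0D !sum_const_card; field.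
Qed.

Lemma fibre00 : fibre 0 0 = 1/10 + (k - 1) / 2 + (k-1)*(k-2)/4.
Proof.
rewrite -sum_inv4 /fibre; apply: eq_bigr => a _; apply: eq_bigr => c _.
congr (_%:R^-1); rewrite /zero_count !addr0 !sub0r.
have -> : a - a + c - c = 0 by ring.
by rewrite -opprD !subrr !iszN !isz0; ring.
Qed.

Lemma fibre0_sum : \sum_C fibre 0 C = 1/10 + (k - 1) / 2 + (k-1)*(k-2)/4
   + (k - 1) * (k ^+ 2 / 2 - 11/12 * k + 2/3).
Proof.
rewrite /fibre exchange_big /=.
have F a : \sum_C \sum_c wt a (0 - a) c (C - c) 0 = \sum_c \sum_d wt a (- a) c d 0.
  rewrite exchange_big; apply: eq_bigr => c _ /=.
  by rewrite [RHS](reindex_inj (addIr (- c))); apply: eq_bigr => d _; rewrite sub0r.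
(* Here e and a+b vanish; the lines c = 0, c = -a, d = 0, d = a add one form each, and c+d = 0 adds
   two because a+b+c+d vanishes with it. *)
have Fn a : a != 0 ->
    \sum_c \sum_d wt a (- a) c d 0 = k ^+ 2 / 2 - 11/12 * k + 2/3.
  move=> /negbTE a0.
  have G c d : wt a (- a) c d 0 =
    ind0 d * (- 6^-1 + 4^-1 * ind0 c + 12^-1 * ind0 (a + c))
    + ind0 (a - d) * (- 6^-1 + 12^-1 * ind0 c + 4^-1 * ind0 (a + c))
    + ind0 (c + d) * (- 4^-1) + (2^-1 - 6^-1 * ind0 c - 6^-1 * ind0 (a + c)).
    rewrite /wt /zero_count !addr0 subrr add0r iszN isz0 -(iszN (- a + d)) opprD opprK.
    rewrite /ind0 /isz a0.
    case: (c =P 0) => [->|/eqP/negbTE c0]; last case: (c =P - a) => [->|/eqP c1];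
    (case: (d =P 0) => [->|/eqP/negbTE d0]; last case: (d =P a) => [->|/eqP d1]);
    rewrite ?subrr ?subr0 ?addNr ?add0r ?addr0 ?eqxx ?oppr_eq0 ?a0 ?c0 ?d0 
      ?(addrC a c) ?addr_eq0 ?(negbTE c1) ?(subr_eq0 a) ?(eq_sym a) ?opprK ?eqr_opp ?(eq_sym a)
      ?(negbTE d1) /=;
      try by field.
    by case: (_ == _) => /=; field.
  have H c : \sum_d wt a (- a) c d 0 =
      ind0 c * (1/3 - k/6) + ind0 (a + c) * (1/3 - k/6) + (k/2 - 7/12).
    under eq_bigr do rewrite G.
    by rewrite !big_split /= sum_ind0 sum_ind0B sum_ind0D !sum_const_card; field.
  under eq_bigr do rewrite H.
  by rewrite !big_split /= sum_ind0 sum_ind0D !sum_const_card; field.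
under eq_bigr do rewrite F.
have Fe a : \sum_c \sum_d wt a (- a) c d 0 =
  ind0 a * (\sum_c \sum_d wt 0 (- 0) c d 0 - (k ^+ 2 / 2 - 11/12 * k + 2/3))
  + (k ^+ 2 / 2 - 11/12 * k + 2/3).
  rewrite /ind0 /isz; have [->|a0] := eqVneq a 0; first by rewrite mul1r subrK.
  by rewrite Fn // mul0r add0r.
under eq_bigr do rewrite Fe.
rewrite big_split /= sum_ind0 sum_const_card.
have -> : \sum_c \sum_d wt 0 (- 0) c d 0 = 1/10 + (k - 1) / 2 + (k-1)*(k-2)/4.
  rewrite -sum_inv4; apply: eq_bigr => c _; apply: eq_bigr => d _.
  by congr (_%:R^-1); rewrite /zero_count oppr0 !addr0 !add0r !isz0; ring.
by field.
Qed.
End ZeroPatterns.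

Arguments isz {Z} x%_ring_scope.
Arguments zero_count {Z} a b c d e.
Arguments wt {Z} a b c d e.
Arguments ind0 {Z} x.

(** * The degenerate part of the sum *)

Section JacobiLike.
Variables (Z : finComNzRingType) (q : algC) (J : Z -> Z -> algC).
Hypothesis JC : forall a c, J a c = J c a.
Hypothesis JV : forall a c, J (- (a + c)) c = J a c.
Hypothesis J00 : J 0 0 = q - 2.
Hypothesis J0x : forall c, c != 0 -> J 0 c = - 1.
Hypothesis JJ : forall a c, a != 0 -> c != 0 -> a + c != 0 ->
  J a c * J (- a) (- c) = q.
Implicit Types a b c d A C : Z.
Local Notation k := (#|Z|%:R : algC).

(** The elements a, c and -(a+c) are the exponents of a Jacobi sum at 0, 1 and oo; [JC] and [JV]
    generate their permutations. *)
Definition generic a c := [&& a != 0, c != 0 & a + c != 0].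
Definition Jgen a c : algC := if generic a c then J a c else 0.
(* At a = c = 0 the three indicators and [q + 1] add up to J(0,0) = q - 2. *)
Definition Jdeg a c : algC := - (ind0 a + ind0 c + ind0 (a + c)) + (q + 1) * (ind0 a * ind0 c).

Lemma J_split a c : J a c = Jgen a c + Jdeg a c.
Proof.
rewrite /Jgen /Jdeg /generic /ind0 /isz.
case: (a =P 0) => [->|/eqP a0]; case: (c =P 0) => [->|/eqP c0]; rewrite ?add0r ?addr0 ?eqxx /=.
- by rewrite J00; ring.
- by rewrite J0x // (negbTE c0) /=; ring.
- by rewrite JC J0x // (negbTE a0) /=; ring.
case: (a + c =P 0) => [ac|/eqP ac0] /=; last by ring.
by rewrite -JV ac oppr0 J0x //=; ring.
Qed.

Lemma generic_C a c : generic a c = generic c a.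
Proof. by rewrite /generic (addrC c); case: (a == 0); case: (c == 0). Qed.

Lemma generic_V a c : generic (- (a + c)) c = generic a c.
Proof.
rewrite /generic oppr_eq0 (_ : - (a + c) + c = - a); last by ring.
by rewrite oppr_eq0; case: (a == 0); case: (c == 0); case: (a + c == 0).
Qed.

Lemma Jgen_C a c : Jgen a c = Jgen c a.
Proof. by rewrite /Jgen generic_C JC. Qed.

Lemma Jgen_V a c : Jgen (- (a + c)) c = Jgen a c.
Proof. by rewrite /Jgen generic_V JV. Qed.

Lemma Jdeg_C a c : Jdeg a c = Jdeg c a.
Proof. by rewrite /Jdeg (addrC c); ring. Qed.

Lemma Jdeg_V a c : Jdeg (- (a + c)) c = Jdeg a c.
Proof.
rewrite /Jdeg (_ : - (a + c) + c = - a); last by ring.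
rewrite /ind0 /isz !oppr_eq0; have [->|c0] := eqVneq c 0; first by rewrite addr0; ring.
by rewrite /=; ring.
Qed.

Definition Rgen := \sum_a \sum_c Jgen a c.
(** The excluded terms d = -c are the products that [JJ] evaluates to q. *)
Definition Sgen := \sum_a \sum_c \sum_(d | c + d != 0) Jgen a c * Jgen (- a) d.

Lemma sum_Jdeg (G : Z -> Z -> algC) :
  \sum_a \sum_c Jdeg a c * G a c =
  - (\sum_c G 0 c) - \sum_a G a 0 - \sum_a G a (- a) + (q + 1) * G 0 0.
Proof.
have E a : \sum_c Jdeg a c * G a c =
    ind0 a * (- (\sum_c G a c) + (q + 1) * G a 0) - G a 0 - G a (- a).
  have D c : Jdeg a c * G a c = ind0 a * (- G a c) + ind0 c * (- G a c + (q + 1) * ind0 a * G a c)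
     + ind0 (a + c) * (- G a c) by rewrite /Jdeg; ring.
  under eq_bigr do rewrite D.
  rewrite !big_split /= sum_ind0 sum_ind0D -big_distrr /= sumrN; ring.
by under eq_bigr do rewrite E; rewrite !big_split /= sum_ind0 !sumrN; ring.
Qed.

Lemma sum_Jdeg_sym (G : Z -> Z -> algC) :
  (forall a c, G a c = G c a) -> (forall a c, G (- (a + c)) c = G a c) ->
  \sum_a \sum_c Jdeg a c * G a c = - 3 * (\sum_c G 0 c) + (q + 1) * G 0 0.
Proof.
move=> GC GV; rewrite sum_Jdeg.
have -> : \sum_a G a 0 = \sum_c G 0 c by apply: eq_bigr => a _; apply: GC.
have -> : \sum_a G a (- a) = \sum_c G 0 c; last by ring.
rewrite (reindex_inj oppr_inj); apply: eq_bigr => a _ /=.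
by rewrite opprK -{1}[a]add0r GV.
Qed.

Definition line a c : algC := \sum_d wt a 0 c d 0.
(** The coefficient of J(a,c) once the other factor J(b,d) is replaced by its degenerate part. *)
Definition Gdeg a c : algC := \sum_b \sum_d Jdeg b d * wt a b c d 0.

(** [Jdeg b d] lives on b = 0, d = 0 and b+d = 0; exchanging 0 with 1, or 0 with oo, moves the last
    two lines onto the first. *)
Lemma GdegE a c : Gdeg a c =
  - line a c - line c a - line (- (a + c)) c + (q + 1) * wt a 0 c 0 0.
Proof.
have -> : line c a = \sum_b wt a b c 0 0 by apply: eq_bigr => b _; rewrite wt_01.
have -> : line (- (a + c)) c = \sum_b wt a b c (- b) 0.
  rewrite /line (reindex_inj oppr_inj); apply: eq_bigr => b _ /=.
  by rewrite [in RHS]wt_0oo !addr0 subrr oppr0.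
by rewrite /Gdeg sum_Jdeg.
Qed.

Lemma Gdeg_C a c : Gdeg a c = Gdeg c a.
Proof.
rewrite /Gdeg exchange_big; apply: eq_bigr => b _; apply: eq_bigr => d _ /=.
by rewrite Jdeg_C wt_01.
Qed.

Lemma Gdeg_V a c : Gdeg (- (a + c)) c = Gdeg a c.
Proof.
rewrite /Gdeg exchange_big [RHS]exchange_big; apply: eq_bigr => d _ /=.
rewrite (reindex_inj (inj_comp oppr_inj (addIr d))); apply: eq_bigr => b _ /=.
by rewrite Jdeg_V [in RHS]wt_0oo !addr0.
Qed.

Lemma Gdeg_generic a c : generic a c ->
  Gdeg a c = - 3 * (k / 2 - 7/12) + (q + 1) / 4.
Proof.
move=> g; have [a0 c0 ac0] := and3P g.
have [a1 c1 ac1] : [/\ - (a + c) != 0, c != 0 & - (a + c) + c != 0].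
  by move: g; rewrite -generic_V => /and3P.
have ca0 : c + a != 0 by rewrite addrC.
rewrite GdegE /line !line_generic //.
(* Exactly the forms b, d, e and b+d+e vanish. *)
have -> : wt a 0 c 0 0 = 4^-1; last by ring.
congr (_%:R^-1); rewrite /zero_count !addr0 !isz0 /isz.
by rewrite (negbTE a0) (negbTE c0) (negbTE ac0).
Qed.

Lemma line0_sum : \sum_c line 0 c = 1/10 + (k - 1) / 2 + (k-1)*(k-2)/4.
Proof.
rewrite -sum_inv4; apply: eq_bigr => c _; apply: eq_bigr => d _.
by congr (_%:R^-1); rewrite /zero_count !addr0 !add0r !isz0; ring.
Qed.

Lemma line_0_sum : \sum_c line c 0 = 1/10 + 2 * (k - 1) / 6 + (k-1)/4 + (k-1)*(k-2)/3.
Proof.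
rewrite -sum_inv3; apply: eq_bigr => c _; apply: eq_bigr => d _.
by congr (_%:R^-1); rewrite /zero_count !addr0 !add0r !isz0; ring.
Qed.

Lemma lineN_sum : \sum_c line (- c) c = 1/10 + 2 * (k - 1) / 6 + (k-1)/4 + (k-1)*(k-2)/3.
Proof.
rewrite -sum_inv3; apply: eq_bigr => c _; apply: eq_bigr => d _.
congr (_%:R^-1); rewrite /zero_count !addr0 !add0r addNr add0r iszN !isz0; ring.
Qed.

Lemma line00 : line 0 0 = 1/10 + (k - 1) / 6.
Proof.
rewrite -sum_inv6; apply: eq_bigr => d _.
by congr (_%:R^-1); rewrite /zero_count !addr0 !add0r !isz0; ring.
Qed.

Lemma sum_Jdeg_Gdeg : \sum_a \sum_c Jdeg a c * Gdeg a c =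
  - 3 * (- (1/10 + (k - 1) / 2 + (k-1)*(k-2)/4)
         - 2 * (1/10 + 2 * (k - 1) / 6 + (k-1)/4 + (k-1)*(k-2)/3)
         + (q + 1) * (1/10 + (k - 1) / 6))
  + (q + 1) * (- 3 * (1/10 + (k - 1) / 6) + (q + 1) / 10).
Proof.
rewrite sum_Jdeg_sym; [|exact: Gdeg_C|exact: Gdeg_V].
have -> : Gdeg 0 0 = - 3 * (1/10 + (k - 1) / 6) + (q + 1) / 10.
  rewrite GdegE addr0 oppr0 line00.
  have -> : wt 0 0 0 0 (0 : Z) = 10^-1 by rewrite /wt /zero_count !addr0 isz0.
  by ring.
have -> : \sum_c Gdeg 0 c = - (1/10 + (k - 1) / 2 + (k-1)*(k-2)/4)
         - 2 * (1/10 + 2 * (k - 1) / 6 + (k-1)/4 + (k-1)*(k-2)/3)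
         + (q + 1) * (1/10 + (k - 1) / 6).
  under eq_bigr do rewrite GdegE add0r.
  rewrite !big_split /= !sumrN line0_sum line_0_sum lineN_sum -big_distrr /=.
  have -> : \sum_c @wt Z 0 0 c 0 0 = 1/10 + (k - 1) / 6; last by ring.
  rewrite -sum_inv6; apply: eq_bigr => d _.
  by congr (_%:R^-1); rewrite /zero_count !addr0 !add0r !isz0; ring.
by ring.
Qed.

Local Notation fibre := (@fibre Z).

Lemma fibre_C A C : fibre A C = fibre C A.
Proof.
rewrite /fibre exchange_big; apply: eq_bigr => c _; apply: eq_bigr => a _ /=.
by rewrite wt_01.
Qed.

Lemma fibre_V A C : fibre (- (A + C)) C = fibre A C.
Proof.
rewrite /fibre exchange_big [RHS]exchange_big; apply: eq_bigr => c _ /=.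
rewrite (reindex_inj (inj_comp oppr_inj (addIr c))); apply: eq_bigr => a _ /=.
rewrite [in RHS]wt_0oo !addr0; congr (wt _ _ _ _ _); ring.
Qed.

Lemma sum_Jdeg_fibre : \sum_A \sum_C Jdeg A C * fibre A C =
  - 3 * (1/10 + (k - 1) / 2 + (k-1)*(k-2)/4
         + (k - 1) * (k ^+ 2 / 2 - 11/12 * k + 2/3))
  + (q + 1) * (1/10 + (k - 1) / 2 + (k-1)*(k-2)/4).
Proof.
rewrite sum_Jdeg_sym; [|exact: fibre_C|exact: fibre_V].
by rewrite fibre0_sum fibre00.
Qed.

Lemma sum_Jgen_const (G : Z -> Z -> algC) u :
  (forall a c, generic a c -> G a c = u) ->
  \sum_a \sum_c Jgen a c * G a c = Rgen * u.
Proof.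
move=> Gu; rewrite /Rgen big_distrl; apply: eq_bigr => a _ /=.
rewrite big_distrl; apply: eq_bigr => c _ /=.
by rewrite /Jgen; case: ifP => [/Gu->|]; rewrite ?mul0r.
Qed.

Lemma sum_Jgen_inv : \sum_a \sum_c Jgen a c * Jgen (- a) (- c) = q * ((k - 1) * (k - 2)).
Proof.
have E a c : Jgen a c * Jgen (- a) (- c) =
   ind0 c * (- q + 2 * q * ind0 a) + ind0 (a + c) * (- q) + q * (1 - ind0 a).
  rewrite /Jgen /generic -opprD !oppr_eq0 /ind0 /isz.
  case: (a =P 0) => [->|/eqP a0]; case: (c =P 0) => [->|/eqP c0];
    rewrite ?add0r ?addr0 ?eqxx ?(negbTE a0) ?(negbTE c0) /=; try by ring.
  by case: eqP => [_|/eqP ac] /=; [ring|rewrite JJ //; ring].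
have F a : \sum_c Jgen a c * Jgen (- a) (- c) = ind0 a * (2 * q - k * q) + (k * q - 2 * q).
  under eq_bigr do rewrite E.
  by rewrite !big_split /= sum_ind0 sum_ind0D !sum_const_card; ring.
by under eq_bigr do rewrite F; rewrite big_split /= sum_ind0 sum_const_card; ring.
Qed.

Lemma sum_Jgen_opp1 : \sum_a \sum_c \sum_d Jgen a c * Jgen (- a) d =
  Sgen + q * ((k - 1) * (k - 2)).
Proof.
rewrite -sum_Jgen_inv -big_split /=; apply: eq_bigr => a _.
rewrite -big_split /=; apply: eq_bigr => c _.
rewrite (bigID (fun d => c + d != 0)) /=; congr (_ + _).
by rewrite (big_pred1 (- c)) // => d; rewrite negbK /= addrC addr_eq0.
Qed.

(** Besides e, only a+b, c+d and a+b+c+d can vanish, and two of them force the third. The weight is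
    thus 1, 1/2 or 1/4, that is 1 minus 1/2 per vanishing form, plus 3/4 when all three vanish. The
    symmetries of J make the three half-weighted sums equal. *)
Lemma sum_Jgen_Jgen :
  \sum_a \sum_c \sum_b \sum_d Jgen a c * Jgen b d * wt a b c d 0 =
  Rgen ^+ 2 - 3/2 * Sgen - 3/4 * (q * ((k - 1) * (k - 2))).
Proof.
have E a b c d : Jgen a c * Jgen b d * wt a b c d 0 =
    Jgen a c * Jgen b d
    + ind0 (a + b) * (- 2^-1 * (Jgen a c * Jgen b d))
    + ind0 (c + d) * (- 2^-1 * (Jgen a c * Jgen b d))
    + ind0 ((a + c + d) + b) * (- 2^-1 * (Jgen a c * Jgen b d))
    + ind0 (a + b) * ind0 (c + d) * (3/4 * (Jgen a c * Jgen b d)).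
  rewrite /Jgen; case: ifP => [|_]; last by ring.
  case/and3P=> /negbTE a0 /negbTE c0 /negbTE ac; case: ifP => [|_]; last by ring.
  case/and3P=> /negbTE b0 /negbTE d0 /negbTE bd.
  have -> : a + c + d + b = a + b + (c + d) by ring.
  rewrite /wt /zero_count !addr0 -(addrA _ c d) isz0 /ind0 /isz a0 c0 b0 d0 ac bd.
  case: (a + b =P 0) => [->|/eqP/negbTE ab].
    by rewrite add0r; case: (_ == _) => /=; field.
  case: (c + d =P 0) => [->|/eqP/negbTE cd]; first by rewrite addr0 ab /=; field.
  by case: (_ == _) => /=; field.
have F1 : \sum_a \sum_c \sum_b \sum_d Jgen a c * Jgen b d = Rgen ^+ 2.
  rewrite expr2 {1}/Rgen big_distrl; apply: eq_bigr => a _ /=.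
  rewrite big_distrl; apply: eq_bigr => c _ /=.
  rewrite /Rgen big_distrr; apply: eq_bigr => b _ /=.
  by rewrite big_distrr.
have F2 : \sum_a \sum_c \sum_d Jgen a c * Jgen d (- c) = Sgen + q * ((k - 1) * (k - 2)).
  rewrite -sum_Jgen_opp1 exchange_big; apply: eq_bigr => a _; apply: eq_bigr => c _ /=.
  by apply: eq_bigr => d _; rewrite Jgen_C (Jgen_C d).
have F3 : \sum_a \sum_c \sum_d Jgen a c * Jgen (- (a + c + d)) d = Sgen + q * ((k - 1) * (k - 2)).
  rewrite -sum_Jgen_opp1 exchange_big [RHS]exchange_big; apply: eq_bigr => c _ /=.
  rewrite (reindex_inj (inj_comp oppr_inj (addIr c))); apply: eq_bigr => a _ /=.
  apply: eq_bigr => d _; rewrite Jgen_V -[in RHS]Jgen_V.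
  congr (_ * Jgen _ _); ring.
rewrite (_ : _ - _ - _ = Rgen ^+ 2
    - 2^-1 * (\sum_a \sum_c \sum_d Jgen a c * Jgen (- a) d)
    - 2^-1 * (\sum_a \sum_c \sum_d Jgen a c * Jgen d (- c))
    - 2^-1 * (\sum_a \sum_c \sum_d Jgen a c * Jgen (- (a + c + d)) d)
    + 3/4 * (\sum_a \sum_c Jgen a c * Jgen (- a) (- c))); last first.
  by rewrite F2 F3 sum_Jgen_opp1 sum_Jgen_inv; field.
rewrite -F1 !big_distrr /= -!sumrN -!big_split /=; apply: eq_bigr => a _.
rewrite !big_distrr /= -!sumrN -!big_split /=; apply: eq_bigr => c _.
have G b : \sum_d Jgen a c * Jgen b d * wt a b c d 0 =
   \sum_d Jgen a c * Jgen b d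
   + ind0 (a + b) * (- 2^-1 * \sum_d Jgen a c * Jgen b d)
   - 2^-1 * (Jgen a c * Jgen b (- c))
   + \sum_d ind0 (a + c + d + b) * (- 2^-1 * (Jgen a c * Jgen b d))
   + ind0 (a + b) * (3/4 * (Jgen a c * Jgen b (- c))).
  under eq_bigr do rewrite E -!mulrA.
  rewrite !big_split /= -!big_distrr /= sum_ind0D.
  congr (_ + _ + _ + _ + _); first by ring.
  rewrite -(@sum_ind0D _ c (fun d => ind0 (a + b) * (3 / 4 * (Jgen a c * Jgen b d)))) big_distrr /=.
  by apply: eq_bigr => d _; ring.
under eq_bigr do rewrite G.
rewrite !big_split /= !sum_ind0D; congr (_ + _ + _ + _ + _).
- by ring.
- by rewrite sumrN big_distrr.
rewrite exchange_big /= big_distrr -sumrN; apply: eq_bigr => d _ /=.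
by rewrite sum_ind0D; ring.
Qed.

(** In the product each J is generic plus degenerate, and the two mixed terms agree by exchanging x
    and y. The coefficient of [Rgen], before the factor 10, is twice the generic value of [Gdeg]
    minus that of [fibre], namely (q+1)/2 - k^2: the terms linear in k cancel. *)
Lemma sum_deg : \sum_a \sum_c \sum_b \sum_d
   (J a c * J b d - J (a + b) (c + d)) * wt a b c d 0 * 10 =
  10 * Rgen ^+ 2 + 5 * (q - 2 * k ^+ 2 + 1) * Rgen - 15 * Sgen
  + q ^+ 2 - 5 * (2 * k ^+ 2 - 3 * k + 2) * q
  + 15 * k ^+ 3 - 10 * k ^+ 2 + 1.
Proof.
have Ffib : \sum_a \sum_c \sum_b \sum_d J (a + b) (c + d) * wt a b c d 0 =
   \sum_A \sum_C J A C * fibre A C.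
  rewrite exchange_big /=.
  transitivity (\sum_c \sum_a \sum_A \sum_C J A C * wt a (A - a) c (C - c) 0).
    apply: eq_bigr => c _; apply: eq_bigr => a _.
    rewrite [RHS](reindex_inj (addrI a)); apply: eq_bigr => A _ /=.
    rewrite [RHS](reindex_inj (addrI c)); apply: eq_bigr => C _ /=.
    by rewrite !(addrAC _ _ (- _)) !subrr !add0r.
  rewrite exchange_big /=.
  under eq_bigr do rewrite exchange_big /=.
  rewrite exchange_big /=; apply: eq_bigr => A _.
  under eq_bigr do rewrite exchange_big /=.
  rewrite exchange_big /=; apply: eq_bigr => C _.
  rewrite /fibre big_distrr; apply: eq_bigr => a _ /=.
  by rewrite big_distrr.
have FR : \sum_A \sum_C J A C * fibre A C =
   Rgen * (k ^+ 2 - 3 * k + 7/2) + \sum_A \sum_C Jdeg A C * fibre A C.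
  rewrite -(@sum_Jgen_const fibre); last first.
    by move=> a c /and3P[a0 c0 ac]; apply: fibre_generic.
  rewrite -big_split; apply: eq_bigr => A _; rewrite -big_split; apply: eq_bigr => C _ /=.
  by rewrite J_split mulrDl.
have FG : \sum_a \sum_c \sum_b \sum_d J a c * J b d * wt a b c d 0 =
    \sum_a \sum_c \sum_b \sum_d Jgen a c * Jgen b d * wt a b c d 0
    + 2 * (\sum_a \sum_c Jgen a c * Gdeg a c) + \sum_a \sum_c Jdeg a c * Gdeg a c.
  have X : \sum_a \sum_c \sum_b \sum_d Jdeg a c * Jgen b d * wt a b c d 0
     = \sum_a \sum_c Jgen a c * Gdeg a c.
    transitivity (\sum_b \sum_d \sum_a \sum_c Jdeg a c * Jgen b d * wt a b c d 0).
      under eq_bigr do rewrite exchange_big /=.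
      rewrite exchange_big /=; apply: eq_bigr => b _.
      under eq_bigr do rewrite exchange_big /=.
      by rewrite exchange_big.
    apply: eq_bigr => b _; apply: eq_bigr => d _; rewrite big_distrr; apply: eq_bigr => a _ /=.
    by rewrite big_distrr; apply: eq_bigr => c _ /=; rewrite wt_xy; ring.
  rewrite mulr_natl mulr2n -{1}X -!big_split; apply: eq_bigr => a _ /=.
  rewrite -!big_split; apply: eq_bigr => c _ /=.
  rewrite /Gdeg !big_distrr -!big_split; apply: eq_bigr => b _ /=.
  rewrite !big_distrr -!big_split; apply: eq_bigr => d _ /=.
  by rewrite !J_split; ring.
transitivity (10 * ((\sum_a \sum_c \sum_b \sum_d J a c * J b d * wt a b c d 0)
   - (\sum_a \sum_c \sum_b \sum_d J (a + b) (c + d) * wt a b c d 0))).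
  rewrite -sumrB big_distrr; apply: eq_bigr => a _ /=.
  rewrite -sumrB big_distrr; apply: eq_bigr => c _ /=.
  rewrite -sumrB big_distrr; apply: eq_bigr => b _ /=.
  rewrite -sumrB big_distrr; apply: eq_bigr => d _ /=.
  by ring.
rewrite Ffib FR FG (sum_Jgen_const Gdeg _ Gdeg_generic) sum_Jgen_Jgen sum_Jdeg_Gdeg sum_Jdeg_fibre.
by field.
Qed.
End JacobiLike.

(** * Character sums over the line and the plane *)

Section CharacterSums.
Variables (Z : finComNzRingType) (F : finFieldType) (X : Z -> F -> algC).
Hypothesis XD : forall s t x, X (s + t) x = X s x * X t x.
Hypothesis XM : forall t x y, X t (x * y) = X t x * X t y.
Hypothesis Xz : forall t, X t 0 = 0.
Hypothesis X0 : forall x, x != 0 -> X 0 x = 1.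
Hypothesis XN : forall t x, X t (- x) = X t x.
Hypothesis sumX : forall t, t != 0 -> \sum_x X t x = 0.
Implicit Types (a b c d e s t : Z) (x y u v : F).
Local Notation q := (#|F|%:R : algC).

Lemma X1 t : X t 1 = 1.
Proof.
have h : X t 1 * X (- t) 1 = 1 by rewrite -XD subrr X0 ?oner_eq0.
have n0 : X t 1 != 0 by apply: contra_eq_neq h => ->; rewrite mul0r eq_sym oner_eq0.
by apply: (mulfI n0); rewrite -XM !mulr1.
Qed.

Lemma XV t x : X t x^-1 = X (- t) x.
Proof.
have [->|x0] := eqVneq x 0; first by rewrite invr0 !Xz.
have h : X t x * X (- t) x = 1 by rewrite -XD subrr X0.
have n0 : X t x != 0 by apply: contra_eq_neq h => ->; rewrite mul0r eq_sym oner_eq0.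
by apply: (mulfI n0); rewrite h -XM divff ?X1.
Qed.

Lemma XNt t x : x != 0 -> X t x * X (- t) x = 1.
Proof. by move=> x0; rewrite -XD subrr X0. Qed.

Lemma XC t x y : X t (x - y) = X t (y - x).
Proof. by rewrite -XN opprB. Qed.

Lemma X0E x : X 0 x = 1 - ind0 x.
Proof.
rewrite /ind0 /isz; have [->|x0] := eqVneq x 0; first by rewrite Xz subrr.
by rewrite X0 // subr0.
Qed.

Definition char_sum5 a b c d e : algC :=
  \sum_x \sum_y X a x * X b y * X c (1 - x) * X d (1 - y) * X e (x - y).

Definition jac a c : algC := \sum_x X a x * X c (1 - x).

Lemma jacC a c : jac a c = jac c a.
Proof.
rewrite /jac (reindex_inj (subrI 1)); apply: eq_bigr => x _ /=.
by rewrite subKr mulrC.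
Qed.

Lemma X1V t x : x != 0 -> X t (1 - x^-1) = X t (1 - x) * X (- t) x.
Proof. by move=> x0; rewrite -XV -XM mulrBl divff // mul1r XC. Qed.

(** Substitute 1/x for x, which fixes 1 and exchanges 0 and oo. *)
Lemma jacV a c : jac (- (a + c)) c = jac a c.
Proof.
rewrite /jac (reindex_inj invr_inj); apply: eq_bigr => x _ /=.
have [->|x0] := eqVneq x 0; first by rewrite invr0 !Xz !mul0r.
by rewrite XV X1V // opprK XD -[RHS]mulr1 -(XNt c _ x0); ring.
Qed.

Lemma jac00 : jac 0 0 = q - 2.
Proof.
rewrite /jac; have E x : X 0 x * X 0 (1 - x) = 1 - ind0 x * 1 - ind0 (1 - x) * 1.
  rewrite !X0E /ind0 /isz; have [->|_] := eqVneq x 0; last by rewrite /=; ring.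
  by rewrite subr0 oner_eq0 /=; ring.
under eq_bigr do rewrite E.
by rewrite !big_split /= !sumrN sum_ind0 sum_ind0B sum_const_card; ring.
Qed.

Lemma jac0x c : c != 0 -> jac 0 c = - 1.
Proof.
move=> c0; rewrite /jac; under eq_bigr do rewrite X0E mulrBl mul1r.
rewrite big_split /= sumrN sum_ind0 subr0 X1.
have -> : \sum_x X c (1 - x) = 0.
  by rewrite -[RHS](sumX _ c0) [RHS](reindex_inj (subrI 1)).
exact: add0r.
Qed.

(* Scaling x by y turns the product into a double sum whose inner sum is taken
   along the bijection y |-> (1 - u y)/(1 - y) = u + (1 - u)/(1 - y). *)
Lemma jac_inv a c : a != 0 -> c != 0 -> a + c != 0 ->
  jac a c * jac (- a) (- c) = q.
Proof.
move=> a0 c0 ac0.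
have E : jac a c * jac (- a) (- c) =
    \sum_u X a u * \sum_y X 0 y * X c (1 - u * y) * X (- c) (1 - y).
  rewrite mulrC /jac big_distrl.
  transitivity (\sum_y \sum_u X a u * (X 0 y * X c (1 - u * y) * X (- c) (1 - y))).
    apply: eq_bigr => y _ /=.
    have [->|y0] := eqVneq y 0.
      by rewrite Xz !mul0r big1 // => u _; rewrite Xz !mul0r mulr0.
    rewrite big_distrr (reindex_inj (mulIf y0)); apply: eq_bigr => u _ /=.
    by rewrite XM -(subrr a) XD; ring.
  rewrite exchange_big; apply: eq_bigr => u _ /=.
  by rewrite big_distrr.
have G u : u != 0 -> u != 1 -> \sum_y X 0 y * X c (1 - u * y) * X (- c) (1 - y)
    = - 1 - X c u.
  move=> u0 u1.
  have inj : injective (fun y => u + (1 - u) * (1 - y)^-1).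
    apply: inj_comp (addrI u) _; apply: inj_comp (mulfI _) _; first by rewrite subr_eq0 eq_sym.
    exact: inj_comp invr_inj (subrI 1).
  (* The total map sends 0 to 1 and, since 0^-1 = 0, sends 1 to u; these are the two values
     subtracted, because the original summand vanishes at y = 0 and y = 1. *)
  transitivity (\sum_y (X c (u + (1 - u) * (1 - y)^-1) - ind0 y * X c 1 - ind0 (1 - y) * X c u)).
    apply: eq_bigr => y _; rewrite /ind0 /isz.
    have [->|y0] := eqVneq y 0.
      have -> : u + (1 - u) * (1 - 0)^-1 = 1 by rewrite subr0 invr1; ring.
      by rewrite Xz subr0 oner_eq0 /=; ring.
    have [/eqP|y1] := eqVneq (1 - y) 0.
      rewrite subr_eq0 => /eqP <-.
      have -> : u + (1 - u) * (1 - 1)^-1 = u by rewrite subrr invr0 mulr0 addr0.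
      by rewrite subrr Xz /=; ring.
    rewrite X0 // -XV -mulrA -XM mul1r /= !mul0r !subr0; congr (X c _).
    by field; rewrite y1.
  have -> : - 1 - X c u = \sum_y X c y - 1 - X c u by rewrite sumX //; ring.
  rewrite !big_split /= !sumrN sum_ind0 sum_ind0B X1.
  by rewrite [in RHS](reindex_inj inj).
rewrite E.
transitivity (\sum_u (ind0 (1 - u) * q - X a u - X (a + c) u)); last first.
  by rewrite !big_split /= !sumrN sum_ind0B !sumX //; ring.
apply: eq_bigr => u _; rewrite /ind0 /isz.
have [->|u0] := eqVneq u 0; first by rewrite !Xz !subr0 oner_eq0 /=; ring.
have [/eqP|u1] := eqVneq (1 - u) 0.
  rewrite subr_eq0 => /eqP <-; rewrite !X1.
  transitivity (jac 0 0); last by rewrite jac00 /=; ring.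
  rewrite mul1r; apply: eq_bigr => y _.
  by rewrite mul1r -mulrA -XD subrr.
rewrite G //; first by rewrite XD /=; ring.
by apply: contra_neq u1 => ->; rewrite subrr.
Qed.

Lemma char_sum5_e0 a b c d : char_sum5 a b c d 0 = jac a c * jac b d - jac (a + b) (c + d).
Proof.
rewrite /char_sum5 /jac big_distrl -sumrB; apply: eq_bigr => x _ /=.
under eq_bigr do rewrite X0E mulrBr mulr1.
rewrite big_split /= big_distrr /=; congr (_ + _).
  by apply: eq_bigr => y _; ring.
under eq_bigr do rewrite mulrC -mulrN.
by rewrite sum_ind0B !XD; ring.
Qed.

Lemma char_sum5_xy a b c d e : char_sum5 b a d c e = char_sum5 a b c d e.
Proof.
rewrite /char_sum5 exchange_big; apply: eq_bigr => x _; apply: eq_bigr => y _ /=.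
by rewrite (XC e y x); ring.
Qed.

Lemma char_sum5_01 a b c d e : char_sum5 c d a b e = char_sum5 a b c d e.
Proof.
rewrite /char_sum5 (reindex_inj (subrI 1)); apply: eq_bigr => x _ /=.
rewrite (reindex_inj (subrI 1)); apply: eq_bigr => y _ /=.
rewrite !subKr (_ : 1 - x - (1 - y) = y - x); last by ring.
by rewrite (XC e y x); ring.
Qed.

Lemma char_sum5_0oo a b c d e :
  char_sum5 (- (a + c + e)) (- (b + d + e)) c d e = char_sum5 a b c d e.
Proof.
rewrite /char_sum5 (reindex_inj invr_inj); apply: eq_bigr => x _ /=.
rewrite (reindex_inj invr_inj); apply: eq_bigr => y _ /=.
have [->|x0] := eqVneq x 0; first by rewrite invr0 !Xz !mul0r.
have [->|y0] := eqVneq y 0; first by rewrite invr0 !Xz !(mulr0, mul0r).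
rewrite !X1V // (_ : x^-1 - y^-1 = (y - x) * x^-1 * y^-1); last by field; rewrite x0 y0.
rewrite !XM !XV !opprK !XD (XC e y x) -[RHS]mulr1 -(XNt c _ x0) -[RHS]mulr1 -(XNt d _ y0).
by rewrite -[RHS]mulr1 -(XNt e _ x0) -[RHS]mulr1 -(XNt e _ y0); ring.
Qed.

(** Dividing the five points by x fixes 0 and oo and turns 1, x, y into 1/x, 1, y/x, so that 1 and x
    trade roles. *)
Lemma char_sum5_1x a b c d e : char_sum5 (- (a + b + c + d + e)) b c e d = char_sum5 a b c d e.
Proof.
rewrite /char_sum5 (reindex_inj invr_inj); apply: eq_bigr => x _ /=.
have [->|x0] := eqVneq x 0.
  by rewrite invr0 !big1 // => y _; rewrite !Xz !mul0r.
have x1 : x^-1 != 0 by rewrite invr_eq0.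
rewrite (reindex_inj (mulIf x1)); apply: eq_bigr => y _ /=.
rewrite X1V // (_ : 1 - y / x = (x - y) * x^-1); last by field.
rewrite (_ : x^-1 - y / x = (1 - y) * x^-1); last by field.
rewrite !XM !XV !opprK !XD -[RHS]mulr1 -(XNt b _ x0) -[RHS]mulr1 -(XNt c _ x0).
by rewrite -[RHS]mulr1 -(XNt d _ x0) -[RHS]mulr1 -(XNt e _ x0); ring.
Qed.

Local Notation P := (Z * Z * Z * Z * Z)%type.

Lemma sum_pair (A B : finType) (f : A * B -> algC) :
  \sum_p f p = \sum_a \sum_b f (a, b).
Proof. by rewrite pair_bigA; apply: eq_bigr => -[]. Qed.

Definition degenerate (f : P) : bool :=
  let: (a, b, c, d, e) := f in zero_count a b c d e != 0%N.

(* Each of the ten forms is carried to [e] by the involutions exchanging the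
   points x and y, 0 and 1, 0 and oo, 1 and x. *)
Lemma sum_char_sum5_degenerate :
  \sum_(f : P | degenerate f)
    (let: (a, b, c, d, e) := f in char_sum5 a b c d e) =
  \sum_a \sum_c \sum_b \sum_d char_sum5 a b c d 0 * wt a b c d 0 * 10.
Proof.
pose TW (f : P) := let: (a, b, c, d, e) := f in char_sum5 a b c d e * wt a b c d e.
pose S (g : P -> Z) := \sum_(f : P) ind0 (g f) * TW f.
have symS (s : P -> P) g g' : involutive s -> (forall f, TW (s f) = TW f) ->
    (forall f, isz (g (s f)) = isz (g' f)) -> S g = S g'.
  move=> sK sT sg; rewrite /S (reindex_inj (inv_inj sK)); apply: eq_bigr => f _.
  by rewrite sT /ind0 sg.
pose sxy (f : P) := let: (a, b, c, d, e) := f in (b, a, d, c, e).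
pose s01 (f : P) := let: (a, b, c, d, e) := f in (c, d, a, b, e).
pose s0oo (f : P) := let: (a, b, c, d, e) := f in (- (a + c + e), - (b + d + e), c, d, e).
pose s1x (f : P) := let: (a, b, c, d, e) := f in (- (a + b + c + d + e), b, c, e, d).
have xy g g' : (forall f, isz (g (sxy f)) = isz (g' f)) -> S g = S g'.
  apply: symS => [[[[[a b] c] d] e]//|[[[[a b] c] d] e]].
  by rewrite /TW /= char_sum5_xy -wt_xy.
have z1 g g' : (forall f, isz (g (s01 f)) = isz (g' f)) -> S g = S g'.
  apply: symS => [[[[[a b] c] d] e]//|[[[[a b] c] d] e]].
  by rewrite /TW /= char_sum5_01 -wt_01.
have zo g g' : (forall f, isz (g (s0oo f)) = isz (g' f)) -> S g = S g'.
  apply: symS => [[[[[a b] c] d] e]|[[[[a b] c] d] e]] /=.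
    by congr (_, _, _, _, _); ring.
  by rewrite char_sum5_0oo -wt_0oo.
have ox g g' : (forall f, isz (g (s1x f)) = isz (g' f)) -> S g = S g'.
  apply: symS => [[[[[a b] c] d] e]|[[[[a b] c] d] e]] /=.
    by congr (_, _, _, _, _); ring.
  by rewrite char_sum5_1x -wt_1x.
pose pa (f : P) := let: (a, b, c, d, e) := f in a.
pose pb (f : P) := let: (a, b, c, d, e) := f in b.
pose pc (f : P) := let: (a, b, c, d, e) := f in c.
pose pd (f : P) := let: (a, b, c, d, e) := f in d.
pose pe (f : P) := let: (a, b, c, d, e) := f in e.
have Ed : S pd = S pe by apply: ox => -[[[[a b] c] d] e].
have Ec : S pc = S pe by rewrite -Ed; apply: xy => -[[[[a b] c] d] e].
have Ea : S pa = S pe by rewrite -Ec; apply: z1 => -[[[[a b] c] d] e].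
have Eb : S pb = S pe by rewrite -Ed; apply: z1 => -[[[[a b] c] d] e].
have Eace : S (fun f => pa f + pc f + pe f) = S pe.
  rewrite -Ea; apply: zo => -[[[[a b] c] d] e] /=.
  by rewrite -[RHS]iszN; congr isz; ring.
have Ebde : S (fun f => pb f + pd f + pe f) = S pe.
  rewrite -Eb; apply: zo => -[[[[a b] c] d] e] /=.
  by rewrite -[RHS]iszN; congr isz; ring.
have Eabe : S (fun f => pa f + pb f + pe f) = S pe.
  rewrite -Eace; apply: ox => -[[[[a b] c] d] e] /=.
  by rewrite -[RHS]iszN; congr isz; ring.
have Ecde : S (fun f => pc f + pd f + pe f) = S pe.
  by rewrite -Eabe; apply: z1 => -[[[[a b] c] d] e] /=.
have Eall : S (fun f => pa f + pb f + pc f + pd f + pe f) = S pe.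
  rewrite -Ea; apply: ox => -[[[[a b] c] d] e] /=.
  by rewrite -[RHS]iszN; congr isz; ring.
transitivity (S pe * 10).
  rewrite -[LHS]addr0 -[X in _ + X](_ : \sum_(f : P | ~~ degenerate f) (0 : algC) = 0);
    last by rewrite big1.
  have -> : S pe * 10 = S pa + S pb + S pc + S pd + S pe + S (fun f => pa f + pc f + pe f)
     + S (fun f => pb f + pd f + pe f) + S (fun f => pa f + pb f + pe f)
     + S (fun f => pc f + pd f + pe f) + S (fun f => pa f + pb f + pc f + pd f + pe f).
    by rewrite Ea Eb Ec Ed Eace Ebde Eabe Ecde Eall; ring.
  rewrite /S -!big_split /= (bigID degenerate xpredT) /=.
  (* Adding the ten indicators gives [zero_count], which cancels the weight on degenerate tuples and
     kills the term on the others. *)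
  have E a b c d e : (zero_count a b c d e)%:R * (char_sum5 a b c d e * wt a b c d e)
    = if zero_count a b c d e != 0%N then char_sum5 a b c d e else 0.
    rewrite /wt; case: ifPn => [n0|]; last by rewrite negbK => /eqP->; rewrite mul0r.
    by rewrite mulrCA mulfV ?mulr1 // pnatr_eq0.
  congr (_ + _); apply: eq_bigr => -[[[[a b] c] d] e] /= h;
    rewrite /degenerate in h.
    transitivity ((zero_count a b c d e)%:R * (char_sum5 a b c d e * wt a b c d e)).
      by rewrite E h.
    by rewrite /ind0 /zero_count !natrD; ring.
  transitivity ((zero_count a b c d e)%:R * (char_sum5 a b c d e * wt a b c d e)).
    by rewrite E (negbTE h).
  by rewrite /ind0 /zero_count !natrD; ring.
rewrite /S !sum_pair big_distrl; apply: eq_bigr => a _ /=.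
rewrite exchange_big big_distrl; apply: eq_bigr => c _ /=.
rewrite big_distrl; apply: eq_bigr => b _ /=.
rewrite big_distrl; apply: eq_bigr => d _ /=.
by rewrite sum_ind0.
Qed.

Lemma sum_char_sum5_degenerateE (k := #|Z|%:R) (R := Rgen _ jac) (S := Sgen _ jac) :
  \sum_(f : P | degenerate f)
    (let: (a, b, c, d, e) := f in char_sum5 a b c d e) =
  10 * R ^+ 2 + 5 * (q - 2 * k ^+ 2 + 1) * R - 15 * S
  + q ^+ 2 - 5 * (2 * k ^+ 2 - 3 * k + 2) * q
  + 15 * k ^+ 3 - 10 * k ^+ 2 + 1.
Proof.
rewrite sum_char_sum5_degenerate -(sum_deg _ _ _ jacC jacV jac00 jac0x jac_inv).
apply: eq_bigr => a _; apply: eq_bigr => c _; apply: eq_bigr => b _.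
by apply: eq_bigr => d _; rewrite char_sum5_e0.
Qed.
End CharacterSums.

(** * Multiplicative characters and Greene's series *)

Section ExtendedCharacters.
Variable F : finFieldType.
Implicit Types (psi phi A B : mulfun F) (x y u v : F) (w : {unit F}).
Local Notation q := (#|F|%:R : algC).

Lemma q_neq0 : q != 0.
Proof. by rewrite pnatr_eq0 -lt0n; apply/card_gt0P; exists 0. Qed.

Lemma q1_neq0 : q - 1 != 0.
Proof. by rewrite subr_eq0 pnatr_eq1 neq_ltn finNzRing_gt1 orbT. Qed.

Lemma ext0_0 psi : ext0 psi 0 = 0.
Proof. by rewrite /ext0 insubN // unitr0. Qed.

Lemma ext0_unit psi w : ext0 psi (val w) = psi w.
Proof. by rewrite /ext0 valK. Qed.

Lemma unitW x : x != 0 -> exists w : {unit F}, x = val w.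
Proof. by rewrite -unitfE => xU; exists (Sub x xU); rewrite SubK. Qed.

Lemma ext0M psi x y : psi \is a linear_char ->
  ext0 psi (x * y) = ext0 psi x * ext0 psi y.
Proof.
move=> lin; have [->|/unitW[w ->]] := eqVneq x 0; first by rewrite mul0r !ext0_0 mul0r.
have [->|/unitW[w' ->]] := eqVneq y 0; first by rewrite mulr0 !ext0_0 mulr0.
by rewrite -FinRing.val_unitM !ext0_unit lin_charM ?inE.
Qed.

Lemma ext0_1 psi : psi \is a linear_char -> ext0 psi 1 = 1.
Proof. by move=> lin; rewrite -FinRing.val_unit1 ext0_unit lin_char1. Qed.

Lemma ext0_mul psi phi x : ext0 (psi * phi) x = ext0 psi x * ext0 phi x.
Proof. by rewrite /ext0; case: insub => [w|]; rewrite ?mulr0 ?cfunE. Qed.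

Lemma ext0_one x : x != 0 -> ext0 1 x = 1.
Proof. by case/unitW=> w ->; rewrite ext0_unit cfun1E inE. Qed.

Lemma ext0_V psi x : psi \is a linear_char -> ext0 psi^-1 x = ext0 psi x^-1.
Proof.
move=> lin; have [->|/unitW[w ->]] := eqVneq x 0; first by rewrite invr0 !ext0_0.
by rewrite -FinRing.val_unitV !ext0_unit invr_lin_char // cfunE lin_charV_conj ?inE.
Qed.

Lemma ext0_inv_mul psi x : psi \is a linear_char -> x != 0 ->
  ext0 psi x^-1 * ext0 psi x = 1.
Proof. by move=> lin x0; rewrite -ext0M // mulVf // ext0_1. Qed.

Lemma ext0X psi n x : x != 0 -> ext0 (psi ^+ n) x = ext0 psi x ^+ n.
Proof. by case/unitW=> w ->; rewrite !ext0_unit exp_cfunE ?inE. Qed.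

Lemma sum_units (f : F -> algC) : f 0 = 0 ->
  \sum_x f x = \sum_(w : {unit F}) f (val w).
Proof.
move=> f0; rewrite (bigD1 0) //= f0 add0r.
rewrite (reindex_omap (val : {unit F} -> F) insub) /=; last first.
  by move=> x; rewrite -unitfE => xU; rewrite insubT.
by apply: eq_bigl => w; rewrite valK eqxx andbT -unitfE (valP w).
Qed.

Lemma sum_ext0 psi : psi \is a linear_char -> psi != 1 -> \sum_x ext0 psi x = 0.
Proof.
move=> lin n1; rewrite sum_units ?ext0_0 //.
have /existsP[w0 w01] : [exists w, psi w != 1].
  apply: contraNT n1 => /existsPn h; apply/eqP/cfunP => w.
  by rewrite cfun1E inE; apply/eqP; move: (h w); rewrite negbK.
have : (psi w0 - 1) * \sum_(w : {unit F}) ext0 psi (val w) = 0.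
  rewrite mulrBl mul1r; apply/eqP; rewrite subr_eq0; apply/eqP.
  rewrite [RHS](reindex_inj (mulgI w0)) big_distrr; apply: eq_bigr => w _ /=.
  by rewrite -FinRing.val_unitM !ext0_unit lin_charM ?inE.
by move/eqP; rewrite mulf_eq0 subr_eq0 (negbTE w01) => /eqP.
Qed.

Lemma units_abelian : abelian [set: {unit F}].
Proof. exact: cyclic_abelian (field_unit_group_cyclic _). Qed.

Lemma sum_lin_char (f : mulfun F -> algC) :
  \sum_(psi <- irr [set: {unit F}] | psi \is a linear_char) f psi =
  \sum_(i : Iirr [set: {unit F}]) f (tnth (irr [set: {unit F}]) i).
Proof.
rewrite big_tuple; apply: eq_bigl => i.
by have /char_abelianP/(_ i) := units_abelian.
Qed.

(** Column orthogonality against the class of 1, whose centralizer is the whole group of order q-1;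
    every irreducible character is linear because F^* is abelian. *)
Lemma sum_lin_char_ext0 x :
  \sum_(psi <- irr [set: {unit F}] | psi \is a linear_char) ext0 psi x =
  (q - 1) * ind0 (x - 1).
Proof.
rewrite sum_lin_char /ind0 /isz subr_eq0.
have [->|] := eqVneq x 0.
  rewrite eq_sym oner_eq0 mulr0 big1 // => i _; exact: ext0_0.
case/unitW=> w ->.
have := second_orthogonality_relation w (group1 [group of [set: {unit F}]]).
rewrite class1G inE => h.
rewrite -FinRing.val_unit1 (inj_eq val_inj).
transitivity (#|'C_[group of [set: {unit F}]][w]%g|%:R *+ (w == 1%g) : algC).
  rewrite -h; apply: eq_bigr => i _; rewrite ext0_unit.
  have /char_abelianP/(_ i) lin := units_abelian.
  by rewrite (lin_char1 lin) conjC1 mulr1.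
case: eqP => [->|_] /=; last by rewrite mulr0.
have /setIidPl-> : [set: {unit F}] \subset 'C[1]%g.
  by apply/subsetP => v _; apply/cent1P/commute1.
rewrite mulr1 mulr1n card_finField_unit -subn1 natrB //.
by apply/card_gt0P; exists 0.
Qed.

(* The involution u |-> u/(u-1), written as 1 - 1/(1-u) so that it is total with
   1/0 = 0, isolates the dependence on a common factor psi of A and B. *)
Lemma greene_binomE A B : A \is a linear_char -> B \is a linear_char ->
  ext0 A (- 1) = ext0 B (- 1) -> 
  greene_binom A B = q^-1 * \sum_x ext0 A x * ext0 A (1 - x)^-1 * ext0 B (1 - x).
Proof.
move=> linA linB AB.
have inj : injective (fun x => 1 - (1 - x)^-1).
  exact: inj_comp (subrI 1) (inj_comp invr_inj (subrI 1)).
rewrite /greene_binom -mulrA mulrCA; congr (_ * _).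
rewrite /jacobi_sum (reindex_inj inj) big_distrr; apply: eq_bigr => x _ /=.
rewrite subKr ext0_V // invrK.
have [/eqP|x1] := eqVneq (1 - x) 0.
  by rewrite subr_eq0 => /eqP <-; rewrite !subrr !(ext0_0, mulr0, mul0r).
have -> : 1 - (1 - x)^-1 = - 1 * x * (1 - x)^-1 by field; rewrite x1.
rewrite !ext0M // AB.
have BB : ext0 B (- 1) * ext0 B (- 1) = 1.
  by rewrite -ext0M // mulrNN mulr1 ext0_1.
by rewrite -[RHS]mul1r -BB; ring.
Qed.

(** Each binomial becomes q^-1 times a sum in which psi enters only as a value psi(x). Summing over
    psi then forces z x y = 1 and gives a factor q-1, which cancels the one in the prefactor. *)
Lemma greene_3F2_1E (A0 A1 A2 B1 B2 : mulfun F) :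
  all (fun psi => (psi \is a linear_char) && (ext0 psi (- 1) == 1))
    [:: A0; A1; A2; B1; B2] ->
  q ^+ 2 * greene_3F2 A0 A1 A2 B1 B2 1 =
  \sum_x \sum_y ext0 A1 x * ext0 A1 (1 - x)^-1 * ext0 B1 (1 - x)
   * (ext0 A2 y * ext0 A2 (1 - y)^-1 * ext0 B2 (1 - y))
   * ext0 A0 (1 - x * y)^-1.
Proof.
case/and5P=> /andP[lA0 /eqP nA0] /andP[lA1 /eqP nA1] /andP[lA2 /eqP nA2] /andP[lB1 /eqP nB1].
rewrite andbT => /andP[lB2 /eqP nB2].
have E A B psi : A \is a linear_char -> B \is a linear_char -> psi \is a linear_char ->
    ext0 A (- 1) = 1 -> ext0 B (- 1) = 1 ->
    greene_binom (A * psi) (B * psi) =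
    q^-1 * \sum_x ext0 A x * ext0 A (1 - x)^-1 * ext0 B (1 - x) * ext0 psi x.
  move=> lA lB lpsi nA nB; rewrite greene_binomE ?rpredM // ?ext0_mul ?nA ?nB //.
  congr (_ * _); apply: eq_bigr => x _; rewrite !ext0_mul.
  have [/eqP|x1] := eqVneq (1 - x) 0.
    by rewrite subr_eq0 => /eqP <-; rewrite !subrr invr0 !ext0_0; ring.
  rewrite -[RHS]mulr1 -(ext0_inv_mul _ _ lpsi x1); ring.
have E0 psi : psi \is a linear_char -> greene_binom (A0 * psi) psi =
    q^-1 * \sum_z ext0 A0 z * ext0 A0 (1 - z)^-1 * ext0 psi z.
  move=> lpsi; rewrite -{2}[psi]mul1r E ?rpred1 //; last first.
    by rewrite ext0_one // oppr_eq0 oner_eq0.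
  congr (_ * _); apply: eq_bigr => z _.
  have [->|z1] := eqVneq (1 - z) 0; first by rewrite invr0 !ext0_0; ring.
  by rewrite ext0_one // mulr1.
pose f A B (x : F) := ext0 A x * ext0 A (1 - x)^-1 * ext0 B (1 - x).
pose f0 (x : F) := ext0 A0 x * ext0 A0 (1 - x)^-1.
have S : greene_3F2 A0 A1 A2 B1 B2 1 = q / (q - 1) * (q ^- 3 *
   \sum_x \sum_y \sum_z f A1 B1 x * f A2 B2 y * f0 z * ((q - 1) * ind0 (z * (x * y) - 1))).
  congr (_ * _).
  transitivity (\sum_(psi <- irr [set: {unit F}] | psi \is a linear_char)
     q ^- 3 * \sum_x \sum_y \sum_z f A1 B1 x * f A2 B2 y * f0 z * ext0 psi (z * (x * y))).
    apply: eq_bigr => psi lpsi; rewrite E // E // E0 // ext0_1 // mulr1.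
    have -> (a b c : algC) : q^-1 * a * (q^-1 * b) * (q^-1 * c) = q ^- 3 * (b * c * a).
      by rewrite !exprS expr0 mulr1 !invfM; ring.
    congr (_ * _); rewrite big_distrlr big_distrl; apply: eq_bigr => x _ /=.
    rewrite big_distrl; apply: eq_bigr => y _ /=.
    rewrite big_distrr; apply: eq_bigr => z _ /=.
    by rewrite !ext0M // /f /f0; ring.
  rewrite -big_distrr /= exchange_big; congr (_ * _); apply: eq_bigr => x _ /=.
  rewrite exchange_big; apply: eq_bigr => y _ /=.
  rewrite exchange_big; apply: eq_bigr => z _ /=.
  by rewrite -big_distrr /= sum_lin_char_ext0.
rewrite S; transitivity (
  \sum_x \sum_y \sum_z f A1 B1 x * f A2 B2 y * f0 z * ind0 (z * (x * y) - 1)).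
  have -> : \sum_x \sum_y \sum_z f A1 B1 x * f A2 B2 y * f0 z * ((q - 1) * ind0 (z * (x * y) - 1))
    = (q - 1) * \sum_x \sum_y \sum_z f A1 B1 x * f A2 B2 y * f0 z * ind0 (z * (x * y) - 1).
    rewrite big_distrr; apply: eq_bigr => x _ /=.
    rewrite big_distrr; apply: eq_bigr => y _ /=.
    rewrite big_distrr; apply: eq_bigr => z _ /=.
    by ring.
  by field; rewrite q_neq0 q1_neq0.
apply: eq_bigr => x _; apply: eq_bigr => y _.
have [->|x0] := eqVneq x 0.
  by rewrite big1 => [|z _]; rewrite /f ext0_0 !mul0r.
have [->|y0] := eqVneq y 0.
  by rewrite big1 => [|z _]; rewrite /f ext0_0 !(mul0r, mulr0).
have xy0 : x * y != 0 by rewrite mulf_neq0.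
under eq_bigr do rewrite mulrC.
rewrite (@sum_delta F _ _ (x * y)^-1) => [|z]; last first.
  by rewrite subr_eq0 -(inj_eq (mulIf xy0) z) mulVf.
congr (_ * _); rewrite /f0.
have [/eqP|xy1] := eqVneq (1 - x * y) 0.
  by rewrite subr_eq0 => /eqP <-; rewrite invr1 subrr invr0 ext0_0 mulr0.
(* At z = 1/(xy) the quotient z/(1-z) is -1/(1-xy); A0(-1) = 1 absorbs the sign. *)
rewrite -[RHS]mul1r -nA0 -!ext0M //; congr (ext0 A0 _).
have -> : 1 - (x * y)^-1 = - (1 - x * y) / (x * y) by field; rewrite x0 y0.
by field; rewrite x0 y0 oppr_eq0 xy1.
Qed.
End ExtendedCharacters.

(** * Powers of the character of order k *)

Section PowersOfCharacter.
Variables (k : nat) (F : finFieldType) (chi : mulfun F).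
Hypothesis k_ge2 : (1 < k)%N.
Hypothesis chi_lin : chi \is a linear_char.
Hypothesis chi_order : #[chi]%CF = k.
Hypothesis chiN1 : ext0 chi (- 1) = 1.
Local Notation q := (#|F|%:R : algC).
Implicit Types (a b c d s t : 'Z_k) (x y : F).

Definition chiX t x : algC := ext0 (chi ^+ t) x.

Lemma card_Zk : #|'Z_k| = k.
Proof. by rewrite card_ord Zp_cast. Qed.

Lemma chi_mod i : chi ^+ (i %% k) = chi ^+ i.
Proof. by apply: expr_mod; rewrite -chi_order exp_cforder. Qed.

Lemma chi_add s t : chi ^+ (s + t)%R = chi ^+ s * chi ^+ t.
Proof. by rewrite -exprD /= [X in (_ %% X)%N]Zp_cast // chi_mod. Qed.

Lemma chi_opp s : chi ^+ (- s)%R = chi^-1 ^+ s.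
Proof.
have U : chi ^+ s \is a GRing.unit by rewrite unitrX ?lin_char_unitr.
by apply: (mulrI U); rewrite -chi_add exprVn divrr // subrr expr0.
Qed.

Lemma chiX_lin t : chi ^+ t \is a linear_char.
Proof. exact: rpredX. Qed.

Lemma chiXD s t x : chiX (s + t) x = chiX s x * chiX t x.
Proof. by rewrite /chiX chi_add ext0_mul. Qed.

Lemma chiXM t x y : chiX t (x * y) = chiX t x * chiX t y.
Proof. by rewrite /chiX ext0M ?chiX_lin. Qed.

Lemma chiXz t : chiX t 0 = 0.
Proof. exact: ext0_0. Qed.

Lemma chiX0 x : x != 0 -> chiX 0 x = 1.
Proof. by move=> x0; rewrite /chiX expr0 ext0_one. Qed.

Lemma chiXN1 t : chiX t (- 1) = 1.
Proof. by rewrite /chiX ext0X ?oppr_eq0 ?oner_eq0 // chiN1 expr1n. Qed.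

Lemma chiXN t x : chiX t (- x) = chiX t x.
Proof. by rewrite -mulN1r chiXM chiXN1 mul1r. Qed.

Lemma sum_chiX t : t != 0 -> \sum_x chiX t x = 0.
Proof.
move=> t0; apply: sum_ext0; first exact: chiX_lin.
rewrite -dvdn_cforder chi_order; apply: contra t0 => /dvdnP[m tm].
have := ltn_ord t; rewrite {2}Zp_cast // tm; case: m tm => [tm _|m _]; last first.
  by rewrite mulSn ltnNge leq_addr.
by apply/eqP/val_inj; rewrite /= tm.
Qed.

Local Notation char_sum5 := (char_sum5 'Z_k F chiX).
Local Notation jac := (jac 'Z_k F chiX).

Lemma greene_3F2_exp_char_sum5 (t : Z5 k) :
  q ^+ 2 * greene_3F2_exp chi t 1 =
  let: (t1, t2, t3, t4, t5) := t in char_sum5 t2 (t1 - t5) (t4 - t2) (t5 - t3) (- t1).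
Proof.
case: t => -[[[t1 t2] t3] t4] t5; rewrite /greene_3F2_exp greene_3F2_1E; last first.
  by apply/allP => psi; rewrite !inE => /or4P[| | |/orP[]] /eqP->;
    rewrite chiX_lin -/(chiX _ _) chiXN1 eqxx.
(* Replacing y by 1/y turns 1 - xy into (y-x)/y, the difference occurring in [char_sum5]. *)
rewrite /char_sum5; apply: eq_bigr => x _; rewrite (reindex_inj invr_inj); apply: eq_bigr => y _ /=.
rewrite -!/(chiX _ _).
have XV := XV _ _ _ chiXD chiXM chiXz chiX0.
have X1V := X1V _ _ _ chiXD chiXM chiXz chiX0 chiXN.
have [->|y0] := eqVneq y 0; first by rewrite invr0 !chiXz !(mul0r, mulr0).
rewrite !XV !X1V // (_ : 1 - x / y = (y - x) * y^-1); last by field.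
rewrite chiXM XV !opprK !chiXD (XC _ _ _ chiXN _ y x).
by rewrite -[RHS]mulr1 -(XNt _ _ _ chiXD chiX0 t3 _ y0); ring.
Qed.

(** The nine inequalities between t1, t2, t3 and 0, t4, t5, together with the one on sums, are the
    non-vanishing of the ten forms at the substituted exponents. *)
Lemma X_set_zero_count (t : Z5 k) :
  (t \in X_set k) =
  (let: (t1, t2, t3, t4, t5) := t in
   zero_count t2 (t1 - t5) (t4 - t2) (t5 - t3) (- t1) == 0%N).
Proof.
case: t => -[[[t1 t2] t3] t4] t5; rewrite inE /zero_count.
have -> : t2 + (t4 - t2) - t1 = t4 - t1 by ring.
have -> : t1 - t5 + (t5 - t3) - t1 = - t3 by ring.
have -> : t2 + (t1 - t5) - t1 = t2 - t5 by ring.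
have -> : t4 - t2 + (t5 - t3) - t1 = t4 + t5 - (t1 + t2 + t3) by ring.
have -> : t2 + (t1 - t5) + (t4 - t2) + (t5 - t3) - t1 = t4 - t3 by ring.
rewrite !iszN /isz !subr_eq0 !addn_eq0 !eqb0 /= !inE !negb_or.
rewrite (eq_sym t4 t2) (eq_sym t5 t3) (eq_sym t4 t1) (eq_sym t4 t3) (eq_sym (t4 + t5)).
case: (t2 == 0); case: (t1 == t5); case: (t2 == t4); case: (t3 == t5); case: (t1 == 0) => //=;
case: (t1 == t4); case: (t3 == 0); case: (t2 == t5); case: (t3 == t4) => //=.
all: by rewrite ?andbT ?andbF.
Qed.

Lemma sum_3F2 :
  q ^+ 2 * \sum_(t in X_set k) greene_3F2_exp chi t 1 =
  \sum_(f : Z5 k | ~~ degenerate 'Z_k f)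
    (let: (a, b, c, d, e) := f in char_sum5 a b c d e).
Proof.
pose g (t : Z5 k) : Z5 k := let: (t1, t2, t3, t4, t5) := t in
  (t2, t1 - t5, t4 - t2, t5 - t3, - t1).
pose g' (f : Z5 k) : Z5 k := let: (a, b, c, d, e) := f in
  (- e, a, - e - b - d, c + a, - e - b).
have gK : cancel g g'.
  by case=> -[[[t1 t2] t3] t4] t5; rewrite /g /g' /=; congr (_, _, _, _, _); ring.
rewrite [RHS](reindex_inj (can_inj gK)) big_distrr; apply: eq_big => [t|t _].
  by rewrite X_set_zero_count; case: t => -[[[t1 t2] t3] t4] t5 /=; rewrite negbK.
by rewrite /= greene_3F2_exp_char_sum5; case: t => -[[[t1 t2] t3] t4] t5.
Qed.

Lemma sum_nat_Zk (f : nat -> algC) :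
  \sum_(1 <= s < k) f s = \sum_(a : 'Z_k) if a != 0 then f a else 0.
Proof.
(* The carrier of ['Z_k] has (Zp_trunc k).+2 elements, which is k as k is at least 2. *)
have -> : \sum_(1 <= s < k) f s = \sum_(1 <= s < (Zp_trunc k).+2) f s.
  by rewrite Zp_cast.
rewrite big_add1 /= big_mkord [RHS]big_ord_recl eqxx add0r.
by apply: eq_bigr => i _.
Qed.

Lemma Zk_add_eq0 a b : (a + b == 0 %[mod k])%N = (a + b == 0)%R.
Proof. by rewrite -val_eqE /= mod0n [X in _ = (_ %% X == _)%N]Zp_cast. Qed.

Lemma R_sum_Rgen : R_sum k chi = Rgen _ jac.
Proof.
rewrite /R_sum sum_nat_Zk; apply: eq_bigr => a _.
case: ifPn => a0; last first.
  by rewrite big1 // => c _; rewrite /Jgen /generic (negbTE a0).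
rewrite big_mkcond sum_nat_Zk; apply: eq_bigr => c _.
rewrite /Jgen /generic a0 Zk_add_eq0; case: (c == 0) => //=.
Qed.

Lemma S_sum_Sgen : S_sum k chi = Sgen _ jac.
Proof.
rewrite /S_sum sum_nat_Zk; apply: eq_bigr => a _.
case: ifPn => a0; last first.
  by rewrite big1 // => c _; rewrite big1 // => d _; rewrite /Jgen /generic (negbTE a0) mul0r.
rewrite sum_nat_Zk; apply: eq_bigr => c _.
case: ifPn => c0; last first.
  by rewrite big1 // => d _; rewrite /Jgen /generic (negbTE c0) andbF mul0r.
rewrite big_mkcond sum_nat_Zk [RHS]big_mkcond; apply: eq_bigr => d _ /=.
rewrite /Jgen /generic oppr_eq0 a0 c0 !Zk_add_eq0 (addrC d c) /=.
have -> : (d == a %[mod k])%N = (- a + d == 0).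
  have lt_k (s : 'Z_k) : (s < k)%N by have := ltn_ord s; rewrite [X in (_ < X)%N]Zp_cast.
  by rewrite addrC subr_eq0 !modn_small.
case: (d == 0) => /=; first by rewrite mulr0; case: ifP.
case: (a + c == 0) => /=; first by rewrite mul0r; case: ifP.
case: (c + d == 0) => //=; case: (- a + d == 0) => /=; first by rewrite mulr0.
by rewrite -chi_opp.
Qed.

Lemma sum_char_sum5_all (K := k%:R : algC) (R := R_sum k chi) (S := S_sum k chi) :
  \sum_(f : Z5 k) (let: (a, b, c, d, e) := f in char_sum5 a b c d e) =
  10 * R ^+ 2 + 5 * (q - 2 * K ^+ 2 + 1) * R - 15 * S
  + q ^+ 2 - 5 * (2 * K ^+ 2 - 3 * K + 2) * q + 15 * K ^+ 3 - 10 * K ^+ 2 + 1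
  + q ^+ 2 * \sum_(t in X_set k) greene_3F2_exp chi t 1.
Proof.
rewrite sum_3F2 (bigID (degenerate 'Z_k)) /=.
congr (_ + _).
rewrite (sum_char_sum5_degenerateE _ _ _ chiXD chiXM chiXz chiX0 chiXN sum_chiX) card_Zk.
by rewrite /R /S R_sum_Rgen S_sum_Sgen.
Qed.
End PowersOfCharacter.

(** * Counting complete subgraphs *)

Lemma num_complete4 (V : finType) (e : rel V) : symmetric e -> irreflexive e ->
  (num_complete e 4 * 24)%N =
  (\sum_a \sum_b \sum_c \sum_d
    nat_of_bool [&& e a b, e a c, e a d, e b c, e b d & e c d])%N.
Proof.
move=> e_sym e_irr.
pose D := [set t : 4.-tuple V | pairwise e t].
have D_uniq (t : 4.-tuple V) : pairwise e t -> uniq t.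
  rewrite uniq_pairwise; apply: sub_pairwise => x y exy.
  by apply: contraTneq exy => ->; rewrite /= e_irr.
have cardD : #|D| = (num_complete e 4 * 24)%N.
  (* Ordered cliques are grouped by their underlying set; each 4-clique has 24 orderings. *)
  rewrite -sum1_card (partition_big (fun t : 4.-tuple V => [set x in t])
      [in complete_subgraphs e 4]) /=; last first.
    move=> t; rewrite inE => te; rewrite inE cardsE (card_uniqP (D_uniq t te)) size_tuple eqxx /=.
    apply/forall_inP => x; rewrite inE => xt; apply/forall_inP => y; rewrite inE => yt.
    apply/implyP => xy; move: te => /(pairwiseP x) te.
    have [ltx lty] : (index x t < size t)%N /\ (index y t < size t)%N by rewrite !index_mem.
    have xE := nth_index x xt; have yE := nth_index x yt.
    have ne : index x t != index y t.
      by apply: contra_neq xy => h; rewrite -xE h yE.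
    case: (ltngtP (index x t) (index y t)) ne => // h _.
      by have := te _ _ ltx lty h; rewrite xE yE.
    by have := te _ _ lty ltx h; rewrite xE yE e_sym.
  rewrite /num_complete -sum_nat_const; apply: eq_bigr => C.
  rewrite inE => /andP[/eqP C4 /forall_inP Ce].
  rewrite sum1dep_card -[RHS]/(4 ^_ 4)%N -[X in (X ^_ _)%N]C4 -card_uniq_tuples.
  apply: eq_card => t; rewrite !inE.
  apply/andP/andP => [[te /eqP tC]|[/allP tC tu]].
    split; last exact: D_uniq.
    by apply/allP => x xt; have : x \in [set z in t] by [rewrite inE]; rewrite tC.
  have tCE : [set x in t] = C.
    apply/eqP; rewrite eqEcard C4 cardsE (card_uniqP tu) size_tuple leqnn andbT.
    by apply/subsetP => x; rewrite inE => /tC.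
  split; last exact/eqP.
  have := tu; rewrite uniq_pairwise; apply: (@sub_in_pairwise _ [in C]); last exact/allP.
  by move=> x y xC yC /= xy; have /forall_inP/(_ y yC)/implyP/(_ xy) := Ce x xC.
rewrite -cardD -sum1_card big_mkcond /=.
pose h (p : V * V * V * V) : 4.-tuple V := let: (a, b, c, d) := p in [tuple a; b; c; d].
rewrite (reindex h) /=; last first.
  exists (fun t : 4.-tuple V => (tnth t 0, tnth t 1, tnth t 2%:R, tnth t 3%:R)).
    by case=> -[[a b] c] d _ /=; rewrite !(tnth_nth a).
  by move=> t _; apply/val_inj; case: t => [[|a [|b [|c [|d []]]]]].
rewrite !pair_bigA; apply: eq_bigr => -[[[a b] c] d] _.
rewrite inE /= !andbT -!andbA; by case: [&& _, _, _, _, _ & _].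
Qed.

Section PaleyCount.
Variables (k : nat) (F : finFieldType) (chi : mulfun F).
Hypothesis k_ge2 : (1 < k)%N.
Hypothesis chi_lin : chi \is a linear_char.
Hypothesis chi_order : #[chi]%CF = k.
Hypothesis resN1 : - 1 \in power_residues F k.
Local Notation q := (#|F|%:R : algC).
Implicit Types (x y z : F).
Local Notation chiX := (chiX k F chi).

Definition residue_ind x : algC := (x \in power_residues F k)%:R.

Lemma residue0 : 0 \notin power_residues F k.
Proof.
apply/imsetP => -[x]; rewrite !inE => x0 /esym/eqP.
by rewrite expf_eq0 (negbTE x0) andbF.
Qed.

Lemma residueM x y : x \in power_residues F k ->
  (x * y \in power_residues F k) = (y \in power_residues F k).
Proof.
move=> xS; have /imsetP[u u0 xE] := xS; rewrite !inE in u0.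
apply/imsetP/imsetP => -[v]; rewrite !inE => v0 yE.
  exists (v / u); first by rewrite !inE mulf_neq0 ?invr_eq0.
  rewrite expr_div_n -yE -xE mulrAC divff ?mul1r //.
  by apply: contraNneq residue0 => <-.
by exists (u * v); rewrite ?inE ?mulf_neq0 // exprMn -xE yE.
Qed.

Lemma resN x : residue_ind (- x) = residue_ind x.
Proof. by rewrite /residue_ind -mulN1r residueM. Qed.

(** For the converse, write w = g^i with g a generator. If chi(w) = 1 then chi^i is trivial at g,
    hence everywhere, so the order k of chi divides i. *)
Lemma chi_residue x : x != 0 -> (x \in power_residues F k) = (ext0 chi x == 1).
Proof.
case/unitW=> w ->; rewrite ext0_unit; apply/imsetP/eqP => [[y]|chi1].
  rewrite !inE => /unitW[v ->]; rewrite -FinRing.val_unitX => /val_inj->.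
  rewrite lin_charX ?inE //; have /dvdn_cforderP := dvdnn #[chi]%CF.
  by rewrite chi_order => ->; rewrite ?inE.
have /cyclicP[g gE] := field_unit_group_cyclic [group of [set: {unit F}]].
have /cycleP[i wE] : w \in <[g]>%g by rewrite -gE inE.
have /dvdnP[m im] : (k %| i)%N.
  rewrite -chi_order; apply/dvdn_cforderP => u _.
  have /cycleP[j ->] : u \in <[g]>%g by rewrite -gE inE.
  by rewrite -lin_charX ?inE // -expgM mulnC expgM -wE lin_charX ?inE // chi1 expr1n.
exists (val (g ^+ m)%g); last by rewrite -FinRing.val_unitX -expgM -im wE.
by rewrite !inE -unitfE (valP (g ^+ m)%g).
Qed.

Lemma ext0_chiN1 : ext0 chi (- 1) = 1.
Proof. by apply/eqP; rewrite -chi_residue // oppr_eq0 oner_eq0. Qed.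

Lemma k_neq0 : k%:R != 0 :> algC.
Proof. by rewrite pnatr_eq0 -lt0n ltnW. Qed.

(** If chi(x) is not 1 it is a nontrivial k-th root of unity, with zero geometric sum. At x = 0
    every term vanishes, including the trivial character. *)
Lemma res_chiX x : residue_ind x = k%:R^-1 * \sum_(t : 'Z_k) chiX t x.
Proof.
have [->|x0] := eqVneq x 0.
  by rewrite /residue_ind (negbTE residue0) big1 ?mulr0 // => t _; apply: ext0_0.
rewrite /residue_ind chi_residue //.
under eq_bigr do rewrite /chiX ext0X //.
case: eqP => [->|/eqP chi1].
  under eq_bigr do rewrite expr1n.
  by rewrite sumr_const card_Zk // mulVf // k_neq0.
apply/esym/eqP; rewrite mulf_eq0 invr_eq0 (negbTE k_neq0) /=.
have : (ext0 chi x - 1) * \sum_(t < (Zp_trunc k).+2) ext0 chi x ^+ t == 0.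
  by rewrite -subrX1 Zp_cast // -ext0X // -chi_order exp_cforder ext0_one // subrr.
by rewrite mulf_eq0 subr_eq0 (negbTE chi1).
Qed.

Lemma sum_res : \sum_x residue_ind x = k%:R^-1 * (q - 1).
Proof.
under eq_bigr do rewrite res_chiX.
rewrite -big_distrr exchange_big (bigD1 0) //=; congr (_ * _).
rewrite [X in _ + X]big1 => [|t t0]; last exact: sum_chiX.
have X0E := X0E _ _ _ (chiXz k F chi) (chiX0 k F chi).
under eq_bigr do rewrite X0E -[ind0 _]mulr1.
by rewrite addr0 big_split /= sumrN sum_ind0 sum_const_card mulr1.
Qed.

Lemma num_complete_paley :
  (num_complete (@gen_paley F k) 4)%:R * 24 =
  q * (\sum_z residue_ind z) *
  \sum_x \sum_y residue_ind x * residue_ind y * residue_ind (1 - x)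
    * residue_ind (1 - y) * residue_ind (x - y) :> algC.
Proof.
rewrite -natrM num_complete4; first last.
- by move=> x; rewrite /gen_paley subrr (negbTE residue0).
- by move=> x y; rewrite /gen_paley -opprB -mulN1r residueM.
rewrite /gen_paley natr_sum.
pose S := power_residues F k.
have E (a : F) : (\sum_(b : F) \sum_(c : F) \sum_(d : F) nat_of_bool
     [&& a - b \in S, a - c \in S, a - d \in S, b - c \in S, b - d \in S & c - d \in S]%R)%N%:R
   = \sum_b \sum_c \sum_d residue_ind b * (residue_ind c * (residue_ind d
       * (residue_ind (c - b) * (residue_ind (d - b) * residue_ind (d - c))))).
  rewrite natr_sum (reindex_inj (subrI a)); apply: eq_bigr => b _.
  rewrite natr_sum (reindex_inj (subrI a)); apply: eq_bigr => c _.
  rewrite natr_sum (reindex_inj (subrI a)); apply: eq_bigr => d _.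
  have subBB (u v : F) : a - u - (a - v) = v - u by ring.
  by rewrite /= !subKr !subBB /residue_ind -!natrM !mulnb.
under eq_bigr do rewrite E.
rewrite sum_const_card -mulrA; congr (_ * _).
rewrite big_distrl; apply: eq_bigr => z _ /=.
have [->|z0] := eqVneq z 0.
  have r0 : residue_ind 0 = 0 by rewrite /residue_ind (negbTE residue0).
  rewrite r0 mul0r big1 // => c _; rewrite big1 // => d _.
  by rewrite mul0r.
(* The vertices are now a, a-z, a-zx, a-zy; if z is a residue it drops out of the five other
   differences, and otherwise both sides are 0. *)
rewrite (reindex_inj (mulfI z0)) big_distrr; apply: eq_bigr => x _ /=.
rewrite (reindex_inj (mulfI z0)) big_distrr; apply: eq_bigr => y _ /=.
have -> : z * x - z = z * (x - 1) by ring.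
have -> : z * y - z = z * (y - 1) by ring.
rewrite -(mulrBr z y x) -(resN (1 - x)) -(resN (1 - y)) -(resN (x - y)) !opprB.
rewrite /residue_ind; case: (boolP (z \in _)) => [zS|_]; last by rewrite !mul0r.
by rewrite !(residueM _ _ zS); ring.
Qed.

Lemma sum_prod5 (I : finType) (f1 f2 f3 f4 f5 : I -> algC) :
  (\sum_i f1 i) * (\sum_i f2 i) * (\sum_i f3 i) * (\sum_i f4 i) * (\sum_i f5 i) =
  \sum_(p : I * I * I * I * I) (let: (a, b, c, d, e) := p in
    f1 a * f2 b * f3 c * f4 d * f5 e).
Proof.
rewrite !sum_pair !big_distrl; apply: eq_bigr => a _ /=.
rewrite [f1 a * _]big_distrr !big_distrl; apply: eq_bigr => b _ /=.
rewrite [f1 a * f2 b * _]big_distrr !big_distrl; apply: eq_bigr => c _ /=.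
rewrite [f1 a * f2 b * f3 c * _]big_distrr !big_distrl; apply: eq_bigr => d _ /=.
by rewrite big_distrr.
Qed.

Lemma sum_res_char_sum5 :
  \sum_x \sum_y residue_ind x * residue_ind y * residue_ind (1 - x)
    * residue_ind (1 - y) * residue_ind (x - y) =
  k%:R ^- 5 * \sum_(f : Z5 k) (let: (a, b, c, d, e) := f in char_sum5 'Z_k F chiX a b c d e).
Proof.
transitivity (k%:R ^- 5 * \sum_x \sum_y \sum_(f : Z5 k) (let: (a, b, c, d, e) := f in
   chiX a x * chiX b y * chiX c (1 - x) * chiX d (1 - y) * chiX e (x - y))).
  rewrite big_distrr; apply: eq_bigr => x _; rewrite big_distrr; apply: eq_bigr => y _ /=.
  by rewrite -sum_prod5 !res_chiX -exprVn; ring.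
congr (_ * _); under eq_bigr do rewrite exchange_big /=.
rewrite exchange_big /=; apply: eq_bigr => -[[[[a b] c] d] e] _.
by [].
Qed.
End PaleyCount.

Lemma neg1_power_residue (F : finFieldType) (k : nat) :
  (0 < k)%N -> (odd #|F| -> #|F| = 1 %[mod 2 * k]) -> - 1 \in power_residues F k.
Proof.
move=> k0 q_odd.
have q_gt1 : (1 < #|F|)%N := finNzRing_gt1 F.
have [odd_q|even_q] := boolP (odd #|F|); last first.
  have -> : (- 1 : F) = 1.
    (* In even order, -1 = (-1)^q = 1. *)
    rewrite -{1}(expf_card (- 1 : F)) -signr_odd (negbTE even_q) //.
  by apply/imsetP; exists 1; rewrite ?inE ?oner_eq0 ?expr1n.
have /dvdnP[m qm] : (2 * k %| #|F| - 1)%N by rewrite -eqn_mod_dvd 1?ltnW // q_odd.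
have /cyclicP[g gE] := field_unit_group_cyclic [group of [set: {unit F}]].
have g_order : #[g]%g = (#|F| - 1)%N.
  by rewrite orderE -gE /= card_finField_unit subn1.
have m0 : (0 < m)%N by rewrite lt0n; apply/eqP => mE; move: q_gt1; rewrite -subn_gt0 qm mE.
apply/imsetP; exists (val (g ^+ m)%g); first by rewrite !inE -unitfE (valP (g ^+ m)%g).
rewrite -FinRing.val_unitX -expgM; apply/esym/eqP.
(* Since q-1 = 2km, the k-th power of g^m squares to 1 but differs from 1, so it is -1. *)
have : (val (g ^+ (m * k))%g) ^+ 2 == 1.
  rewrite -FinRing.val_unitX -expgM -mulnA (mulnC k) -qm -g_order expg_order.
  by rewrite FinRing.val_unit1.
rewrite sqrf_eq1 => /orP[|//].
rewrite -FinRing.val_unit1 (inj_eq val_inj) -order_dvdn g_order qm.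
rewrite (mulnC 2) mulnA => /dvdn_leq; rewrite muln_gt0 m0 k0 => /(_ isT).
by rewrite leqNgt ltn_Pmulr // muln_gt0 m0.
Qed.

Theorem theorem2p2 (k : nat) (F : finFieldType) (chi : mulfun F)
  (k_ge2 : (2 <= k)%N)
  (q_even : ~~ odd #|F| -> #|F| = 1 %[mod k])
  (q_odd : odd #|F| -> #|F| = 1 %[mod 2 * k])
  (chi_char : chi \is a linear_char)
  (chi_order : #[chi]%CF = k) :
  let q : algC := #|F|%:R in
  let K : algC := k%:R in
  let R := R_sum k chi in
  let S := S_sum k chi in
  (num_complete (@gen_paley F k) 4)%:R =
    q * (q - 1) / (24%:R * K ^+ 6) *
    (10%:R * R ^+ 2 + 5%:R * (q - 2%:R * K ^+ 2 + 1) * R - 15%:R * S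
     + q ^+ 2 - 5%:R * (2%:R * K ^+ 2 - 3%:R * K + 2%:R) * q
     + 15%:R * K ^+ 3 - 10%:R * K ^+ 2 + 1
     + q ^+ 2 * \sum_(t in X_set k) greene_3F2_exp chi t 1).
Proof.
move=> q K R S.
have resN1 : - 1 \in power_residues F k by apply: neg1_power_residue => //; apply: ltnW.
have chiN1 := ext0_chiN1 _ _ _ chi_char chi_order resN1.
have K0 : K != 0 := k_neq0 _ k_ge2.
have count := num_complete_paley k F resN1.
(* The number of residues brings 1/k and the five indicators bring k^-5, whence the k^6 of the
   statement. *)
rewrite (sum_res _ _ _ k_ge2 chi_char chi_order) in count.
rewrite (sum_res_char_sum5 _ _ _ k_ge2 chi_char chi_order) in count.
rewrite (sum_char_sum5_all _ _ _ k_ge2 chi_char chi_order chiN1) in count.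
apply: (@mulIf _ (24%:R : algC)); first by rewrite pnatr_eq0.
rewrite count -/q -/K -/R -/S.
by field.
Qed.
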